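(* Let $G$ be a countable abelian group with identity $0$, and let $\widehat{G}$ be its Pontryagin dual, with identity element $1_{\widehat{G}}$. A set $H\subseteq G\setminus\{0\}$ is a vdC set in $G$ if and only if every Borel probability measure $\mu$ on $\widehat{G}$ with $\widehat{\mu}(h)=0$ for all $h\in H$ satisfies $\mu(\{1_{\widehat{G}}\})=0$.
   Context: $G$ is considered with the discrete topology, so $\widehat{G}$ is compact and metrizable. For a Borel probability measure $\mu$ on $\widehat{G}$, $\widehat{\mu}(h)=\int_{\widehat{G}}\gamma(h)\,d\mu(\gamma)$ for $h\in G$. A measure preserving system $(X,\mathcal{B},\mu,(T_g)_{g\in G})$ is a probability space $(X,\mathcal{B},\mu)$ together with an action $(T_g)_{g\in G}$ of $G$ on $X$ by measure preserving maps. For a countable group $G$ with identity $e$, a set $H\subseteq G\setminus\{e\}$ is a vdC set in $G$ if for every measure preserving system $(X,\mathcal{B},\mu,(T_g)_{g\in G})$ and every (complex valued) $f\in L^\infty(\mu)$: if $\int_{X}f(T_hx)\overline{f(x)}\,d\mu(x)=0$ for all $h\in H$, then $\int_{X}f\,d\mu=0$. *)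

(* Defs.v *)
From HB Require Import structures.
From mathcomp Require Import all_boot all_order all_algebra.
From mathcomp Require Import all_classical all_reals all_analysis.
From mathcomp Require Import complex.

Set Implicit Arguments.
Unset Strict Implicit.
Unset Printing Implicit Defensive.

Import Order.TTheory GRing.Theory Num.Theory.
Import numFieldNormedType.Exports.

Local Open Scope classical_set_scope.
Local Open Scope ring_scope.

(* The Borel sigma-algebra of C. The alias [R[i]^o] carries the topology of
   the complex norm. *)
Definition borelC (R : realType) := g_sigma_algebraType (@open R[i]^o).

HB.instance Definition _ (R : realType) := Measurable.on (borelC R).

Section ComplexIntegration.
Context {d : measure_display} {X : measurableType d} {R : realType}.
Variable mu : probability X R.

(* Meaningful for integrable [f] only: it is applied below to bounded
   measurable functions. *)
Definition cintegral (f : X -> R[i]) : R[i] :=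
  Complex (\int[mu]_x complex.Re (f x)) (\int[mu]_x complex.Im (f x)).

(* [f] represents an element of the complex space L^oo(mu). *)
Definition Linfty (f : X -> R[i]) : Prop :=
  measurable_fun [set: X] (f : X -> borelC R) /\
  finite_norm mu +oo%E (fun x => Normc.normc (f x)).

End ComplexIntegration.

Section VdC.
Context {R : realType} {G : zmodType}.

Definition measure_preserving {d : measure_display} {X : measurableType d}
    (mu : probability X R) (S : X -> X) : Prop :=
  measurable_fun [set: X] S /\
  forall A, measurable A -> mu (S @^-1` A) = mu A.

Definition mp_action {d : measure_display} {X : measurableType d}
    (mu : probability X R) (T : G -> X -> X) : Prop :=
  [/\ T 0 = id,
      forall g h, T (g + h) = T g \o T h
    & forall g, measure_preserving mu (T g)].

(* The requirement that [H] omits the identity is kept as a separate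
   hypothesis. *)
Definition vdC_set (H : set G) : Prop :=
  forall (d : measure_display) (X : measurableType d) (mu : probability X R)
         (T : G -> X -> X),
    mp_action mu T ->
    forall f : X -> R[i], Linfty mu f ->
      (forall h, H h -> cintegral mu (fun x => f (T h x) * conjc (f x)) = 0) ->
      cintegral mu f = 0.

End VdC.

Arguments vdC_set : clear implicits.

(* Continuity of characters is automatic since [G] is discrete. *)
Record dual (R : realType) (G : zmodType) : Type := Character {
  char_fun :> G -> R[i];
  charD : forall g h, char_fun (g + h) = char_fun g * char_fun h;
  char_norm : forall g, `|char_fun g| = 1
}.

Section Dual.
Variables (R : realType) (G : zmodType).

Program Definition dual1 : dual R G := @Character R G (fun=> 1) _ _.
Next Obligation. by move=> g h; rewrite mulr1. Qed.
Next Obligation. by move=> g; rewrite normr1. Qed.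

HB.instance Definition _ := gen_eqMixin (dual R G).
HB.instance Definition _ := gen_choiceMixin (dual R G).
HB.instance Definition _ := isPointed.Build (dual R G) dual1.

(* Compact subsets of the discrete group [G] are finite, so the compact-open
   topology of the dual is the topology of pointwise convergence. *)
HB.instance Definition _ := Topological.copy (dual R G)
  (initial_topology (fun chi : dual R G => (chi : {ptws G -> R[i]^o}))).

Definition borel_dual := g_sigma_algebraType (@open (dual R G)).

HB.instance Definition _ := Measurable.on borel_dual.

Definition fourier_coef (mu : probability borel_dual R) (h : G) : R[i] :=
  cintegral mu (fun chi : dual R G => chi h).

End Dual.

Arguments dual1 {R G}.

(* Main.v *)
(** If [nu] is a measure on the dual whose Fourier coefficients vanish on [H],
    let [G] act on [dual * circle] by [(chi, z) |-> (chi, chi g * z)] and let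
    [f (chi, z)] be [z] if [chi] is nontrivial and [1] otherwise. The
    correlations of [f] are the Fourier coefficients of [nu] and its integral is
    [nu {1}], so the vdC property forces [nu {1} = 0].

    Conversely, given a system and a function [f] of integral [c], the
    correlations of [f - c] are positive definite, hence by Bochner's theorem the
    Fourier coefficients of a finite measure [nu0]; those of [f] are the
    coefficients of [|c|^2 * delta_1 + nu0], which has an atom of mass at least
    [|c|^2] at the trivial character.

    Bochner's theorem is obtained without the Riesz representation theorem.
    Mapping finite groups [(Z/(n+1))^n] to [G] by [k |-> sum_i gamma_i * k_i] and
    taking finite Fourier transforms of the pulled-back function gives finitely
    supported approximations of the measure; their limit along an ultrafilter is
    a finitely additive mean on a set [Omega]. It becomes a countably additive
    measure on the space of ultrafilters of [Omega], where clopen sets are compact,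
    and each bounded function extends there by taking limits along ultrafilters.
    The phases extended in this way are almost surely multiplicative, i.e. they
    form a random character. *)

Require Import Defs.
From HB Require Import structures.
From mathcomp Require Import all_boot all_order all_algebra.
From mathcomp Require Import cyclic separable cyclotomic.
From mathcomp Require Import all_classical all_reals all_analysis.
From mathcomp Require Import measurable_realfun ess_sup_inf complex ring lra.

Set Implicit Arguments.
Unset Strict Implicit.
Unset Printing Implicit Defensive.

Import Order.TTheory GRing.Theory Num.Theory.
Import numFieldNormedType.Exports.

Local Open Scope classical_set_scope.
Local Open Scope ring_scope.

Local Notation Re := complex.Re.
Local Notation Im := complex.Im.

(** * Integration of bounded functions *)

Section BoundedMeasurable.
Context {d : measure_display} {X : measurableType d} {R : realType}.
Implicit Types (f g : X -> R).

(** On a probability space such functions are integrable, and the class is closed under sums and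
    products; integrability side conditions thus reduce to closure lemmas. *)
Definition bmeasurable f :=
  measurable_fun [set: X] f /\ exists M, forall x, `|f x| <= M.

Lemma bmeasurable_cst (c : R) : bmeasurable (fun=> c).
Proof. by split=> //; exists `|c|. Qed.

Lemma bmeasurableD f g : bmeasurable f -> bmeasurable g ->
  bmeasurable (fun x => f x + g x).
Proof.
move=> [mf [M fM]] [mg [N gN]]; split; first exact: measurable_funD.
by exists (M + N) => x; rewrite (le_trans (ler_normD _ _))// lerD.
Qed.

Lemma bmeasurableM f g : bmeasurable f -> bmeasurable g ->
  bmeasurable (fun x => f x * g x).
Proof.
move=> [mf [M fM]] [mg [N gN]]; split; first exact: measurable_funM.
by exists (M * N) => x; rewrite normrM ler_pM.
Qed.

Lemma bmeasurableZ c f : bmeasurable f -> bmeasurable (fun x => c * f x).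
Proof. by move=> ?; apply: bmeasurableM => //; exact: bmeasurable_cst. Qed.

Lemma bmeasurableN f : bmeasurable f -> bmeasurable (fun x => - f x).
Proof.
move=> [mf [M fM]]; split; first exact: measurableT_comp.
by exists M => x; rewrite normrN.
Qed.

Lemma bmeasurableB f g : bmeasurable f -> bmeasurable g ->
  bmeasurable (fun x => f x - g x).
Proof. by move=> bf bg; apply: bmeasurableD => //; exact: bmeasurableN. Qed.

Lemma measurable_fun_if_mem (A : set X) f g : measurable A ->
  measurable_fun [set: X] f -> measurable_fun [set: X] g ->
  measurable_fun [set: X] (fun x => if x \in A then f x else g x).
Proof.
move=> mA mf mg; apply: measurable_fun_ifT => //.
by apply: (measurable_fun_bool true); rewrite setTI preimage_mem_true.
Qed.

Variable mu : probability X R.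

Lemma bmeasurable_integrable f : bmeasurable f ->
  mu.-integrable [set: X] (EFin \o f).
Proof.
move=> [mf [M fM]]; apply: measurable_bounded_integrable => //.
  by rewrite ltey_eq fin_num_measure.
exists M; split; first exact: num_real.
by move=> N MN x _; exact: le_trans (fM x) (ltW MN).
Qed.

Lemma bRintegralD f g : bmeasurable f -> bmeasurable g ->
  \int[mu]_x (f x + g x) = \int[mu]_x f x + \int[mu]_x g x.
Proof. by move=> bf bg; rewrite RintegralD//; exact: bmeasurable_integrable. Qed.

Lemma bRintegralB f g : bmeasurable f -> bmeasurable g ->
  \int[mu]_x (f x - g x) = \int[mu]_x f x - \int[mu]_x g x.
Proof. by move=> bf bg; rewrite RintegralB//; exact: bmeasurable_integrable. Qed.

Lemma bRintegralZ c f : bmeasurable f ->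
  \int[mu]_x (c * f x) = c * \int[mu]_x f x.
Proof. by move=> bf; rewrite RintegralZl//; exact: bmeasurable_integrable. Qed.

Lemma bRintegral_cst c : \int[mu]_x c = c.
Proof. by rewrite Rintegral_cst// [X in fine X](probability_setT mu) mulr1. Qed.

Lemma ble_Rintegral f g : bmeasurable f -> bmeasurable g ->
  (forall x, f x <= g x) -> \int[mu]_x f x <= \int[mu]_x g x.
Proof.
by move=> bf bg fg; apply: le_Rintegral => //; exact: bmeasurable_integrable.
Qed.

End BoundedMeasurable.

(** * Measures on spaces of ultrafilters *)

Record ultra (T : Type) := Ultra {
  ultra_set :> set T -> Prop;
  ultraP : UltraFilter ultra_set
}.

Section Ultra.
Context {T : pointedType}.
Implicit Types (A B : set T) (p : ultra T).

Definition principal_ultra (x : T) : ultra T :=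
  Ultra (principal_filter_ultra x).

Lemma ultraC p A : p (~` A) <-> ~ p A.
Proof.
have := ultraP p => pU; split=> [pC pA|npA].
  by have /filter_ex[x []] : p (A `&` ~` A) by exact: filterI.
by have [//|] := in_ultra_setVsetC A pU.
Qed.

Lemma ultraU p A B : p (A `|` B) <-> p A \/ p B.
Proof.
have := ultraP p => pU; split=> [pAB|[]]; last 2 first.
- by apply: filterS; left.
- by apply: filterS; right.
have [pA|/ultraC pA] := pselect (p A); first by left.
by right; apply: filterS (filterI pAB pA) => x [[]].
Qed.

(* The clopen subsets of the Stone-Cech compactification of the discrete space [T]. *)
Definition ubasic A : set (ultra T) := [set p | p A].

Lemma ubasicC A : ubasic (~` A) = ~` ubasic A.
Proof. by apply/seteqP; split=> p /ultraC. Qed.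

Lemma ubasicU A B : ubasic (A `|` B) = ubasic A `|` ubasic B.
Proof. by apply/seteqP; split=> p /ultraU. Qed.

Lemma ubasic0 : ubasic set0 = set0.
Proof.
apply/seteqP; split=> // p p0; have := ultraP p => pU.
exact: (filter_not_empty (ultra_set p) p0).
Qed.

Lemma ubasicT : ubasic setT = setT.
Proof. by rewrite -setC0 ubasicC ubasic0 setC0. Qed.

(** If no finite union covered [A], the decreasing nonempty sets [B N] would generate a proper
    filter. An ultrafilter refining it contains [A] but no [F n], against the assumed cover. *)
Lemma ubasic_compact A (F : (set T)^nat) :
  ubasic A `<=` \bigcup_n ubasic (F n) ->
  exists N, A `<=` \bigcup_(n < N) F n.
Proof.
move=> AF; apply: contrapT => /forallNP h.
pose B N := A `\` \bigcup_(n < N) F n.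
have FF : ProperFilter (filter_from [set: nat] B).
  apply: filter_from_proper; last first.
    by move=> N _; apply/set0P/eqP; rewrite /B setD_eq0; exact: h.
  apply: filter_from_filter; first by exists 0%N.
  move=> i j _ _; exists (maxn i j) => // x [Ax nF].
  split; split=> // -[k /= ki Fk]; apply: nF; exists k => //=.
    exact: leq_trans ki (leq_maxl _ _).
  exact: leq_trans ki (leq_maxr _ _).
have [p [pU Fp]] := ultraFilterLemma FF.
have pB N : p (B N) by apply: Fp; exists N.
have [|n _ pFn] := AF (Ultra pU).
  by rewrite /ubasic /=; apply: filterS (pB 0%N) => x [].
have : (Ultra pU) (~` F n).
  by rewrite /=; apply: filterS (pB n.+1) => x [_ nF] Fn; apply: nF; exists n => /=.
by move/ultraC; apply.
Qed.

(* Recovers [A] from [ubasic A]. *)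
Definition utrace (S : set (ultra T)) : set T := principal_ultra @^-1` S.

Lemma utrace_ubasic A : utrace (ubasic A) = A.
Proof. by apply/seteqP; split=> x /= /principal_filterP. Qed.

HB.instance Definition _ := gen_eqMixin (ultra T).
HB.instance Definition _ := gen_choiceMixin (ultra T).
HB.instance Definition _ := isPointed.Build (ultra T) (principal_ultra point).

Fact ultra_display : measure_display. Proof. exact. Qed.

Let ubasic_set0 : range ubasic set0.
Proof. by exists set0 => //; exact: ubasic0. Qed.

Let ubasic_setU : setU_closed (range ubasic).
Proof. by move=> _ _ [A _ <-] [B _ <-]; exists (A `|` B) => //; exact: ubasicU. Qed.

Let ubasic_setC : setC_closed (range ubasic).
Proof. by move=> _ [A _ <-]; exists (~` A) => //; exact: ubasicC. Qed.

HB.instance Definition _ := isAlgebraOfSets.Build ultra_display (ultra T)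
  ubasic_set0 ubasic_setU ubasic_setC.

End Ultra.

Record finadd_prob (R : realType) (T : Type) := FinAddProb {
  finadd_fun :> set T -> R;
  finadd_ge0 : forall A, 0 <= finadd_fun A;
  finaddT : finadd_fun setT = 1;
  finaddU : forall A B, A `&` B = set0 ->
    finadd_fun (A `|` B) = finadd_fun A + finadd_fun B
}.

Section FinAddExtension.
Context {R : realType} {T : pointedType} (m : finadd_prob R T).

Lemma finadd0 : m set0 = 0.
Proof.
have := @finaddU _ _ m set0 set0; rewrite setI0 setU0 => /(_ erefl).
by move/eqP; rewrite -subr_eq0 opprD addNKr oppr_eq0 => /eqP.
Qed.

Lemma finadd_bigU (F : (set T)^nat) n : trivIset setT F ->
  m (\big[setU/set0]_(i < n) F i) = \sum_(i < n) m (F i).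
Proof.
move=> tF; elim: n => [|n IH]; first by rewrite !big_ord0 finadd0.
rewrite !big_ord_recr /= finaddU ?IH//.
rewrite big_distrl /= big1 // => i _.
by move/trivIsetP : tF; apply => //; rewrite neq_ltn ltn_ord.
Qed.

(** Defined on all sets of ultrafilters, but meant for the sets [ubasic A], where its value is
    [m A]. *)
Definition ucontent (S : set (ultra T)) : \bar R := (m (utrace S))%:E.

Let ucontent0 : ucontent set0 = 0%E.
Proof. by rewrite /ucontent -ubasic0 utrace_ubasic finadd0. Qed.

Let ucontent_ge0 S : (0 <= ucontent S)%E.
Proof. by rewrite lee_fin finadd_ge0. Qed.

(** By compactness, a countable disjoint union of basic sets that is itself basic is already
    attained by finitely many of them. The partial sums are therefore eventually constant, and
    finite additivity suffices. *)
Let ucontent_sigma_additive : semi_sigma_additive ucontent.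
Proof.
move=> F mF tF [A _ AF].
have [N NP] : exists N, A `<=` \bigcup_(n < N) utrace (F n).
  apply: ubasic_compact => p; rewrite AF => -[i _ Fip]; exists i => //.
  by have [B _ BF] := mF i; rewrite -BF utrace_ubasic /= BF.
have tt : trivIset setT (fun i => utrace (F i)).
  apply/trivIsetP => i j _ _ ij; rewrite -preimage_setI.
  by move/trivIsetP : tF => ->.
have AN n : (N <= n)%N -> A = \big[setU/set0]_(i < n) utrace (F i).
  move=> Nn; rewrite -(bigcup_mkord n (fun i => utrace (F i))); apply/seteqP; split => x.
    by move=> /NP[i /= iN Fx]; exists i => //=; exact: leq_trans Nn.
  move=> [i _ Fx]; rewrite -(utrace_ubasic A) AF.
  by exists i.
apply: cvg_near_cst; near=> n.
have nN : (N <= n)%N by near: n; exists N.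
rewrite big_mkord /ucontent -AF utrace_ubasic [in RHS](AN n nN).
by rewrite (finadd_bigU n tt) sumEFin.
Unshelve. all: by end_near. Qed.

HB.instance Definition _ := isMeasure.Build _ _ _ ucontent
  ucontent0 ucontent_ge0 ucontent_sigma_additive.

End FinAddExtension.

Definition ultraM (T : pointedType) :=
  g_sigma_algebraType (@measurable _ (ultra T)).
HB.instance Definition _ (T : pointedType) := Measurable.on (ultraM T).

Section FinAddProbability.
Context {R : realType} {T : pointedType} (m : finadd_prob R T).

Definition umeasure : set (ultraM T) -> \bar R := measure_extension (ucontent m).

HB.instance Definition _ := Measure.on umeasure.

Lemma umeasureE A : umeasure (ubasic A) = (m A)%:E.
Proof.
rewrite /umeasure /measure_extension measurable_mu_extE; last by exists A.
by rewrite /= /ucontent utrace_ubasic.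
Qed.

Let umeasureT : umeasure setT = 1%E.
Proof. by rewrite -ubasicT umeasureE finaddT. Qed.

HB.instance Definition _ := Measure_isProbability.Build _ _ _ umeasure umeasureT.
End FinAddProbability.

(** * Limits of bounded functions along an ultrafilter *)

Definition bfun {R : realType} {T : Type} (u : T -> R) :=
  exists M, forall x, `|u x| <= M.

Section UltraLimit.
Context {R : realType} {T : Type} (p : ultra T).
Implicit Types (u v : T -> R).

#[local] Instance ultra_properfilter : ProperFilter (ultra_set p).
Proof. by have [] := ultraP p. Qed.

Definition ulim u : R := lim (u x @[x --> (ultra_set p : set_system T)]).

(** The image of an ultrafilter is an ultrafilter; here it contains the compact segment [[-M, M]]
    and hence converges. *)
Lemma ulim_cvg u : bfun u -> u x @[x --> (ultra_set p : set_system T)] --> ulim u.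
Proof.
move=> [M uM].
have pU := ultraP p.
have uU : UltraFilter (u x @[x --> (ultra_set p : set_system T)]).
  split; first exact: fmap_proper_filter.
  move=> F FF uF; apply/seteqP; split=> A; last exact: uF.
  move=> FA; have [//|] := in_ultra_setVsetC (u @^-1` A) pU.
  move=> pA; have /uF FC : (u x @[x --> (ultra_set p : set_system T)]) (~` A) by [].
  by have [y []] := filter_ex (filterI FA FC).
have := @segment_compact R (- M) M; rewrite compact_ultra.
move=> /(_ (u x @[x --> (ultra_set p : set_system T)]) uU)[].
  rewrite /fmap /=; apply: (@filterS _ (ultra_set p) _ setT); last exact: filterT.
  by move=> x _ /=; rewrite in_itv /= -ler_norml.
by move=> l [_ ul]; rewrite /ulim; apply/cvg_ex; exists l.
Qed.

Lemma ulim_eq u l : u x @[x --> (ultra_set p : set_system T)] --> l -> ulim u = l.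
Proof. exact: cvg_lim. Qed.

Lemma ulimD u v : bfun u -> bfun v -> ulim (fun x => u x + v x) = ulim u + ulim v.
Proof. by move=> bu bv; apply: ulim_eq; apply: cvgD; exact: ulim_cvg. Qed.

Lemma ulimM u v : bfun u -> bfun v -> ulim (fun x => u x * v x) = ulim u * ulim v.
Proof. by move=> bu bv; apply: ulim_eq; apply: cvgM; exact: ulim_cvg. Qed.

Lemma ulim_cst (c : R) : ulim (fun=> c) = c.
Proof. by apply: ulim_eq; exact: cvg_cst. Qed.

Lemma ulimZ c u : bfun u -> ulim (fun x => c * u x) = c * ulim u.
Proof. by move=> bu; rewrite ulimM ?ulim_cst//; exists `|c|. Qed.

Lemma ulimB u v : bfun u -> bfun v -> ulim (fun x => u x - v x) = ulim u - ulim v.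
Proof. by move=> bu bv; apply: ulim_eq; apply: cvgB; exact: ulim_cvg. Qed.

Lemma ulim_ge c u : bfun u -> ultra_set p [set x | c <= u x] -> c <= ulim u.
Proof. by move=> bu pc; apply: cvgr_to_ge (ulim_cvg bu) _. Qed.

Lemma ulim_le u v : bfun u -> bfun v -> (forall x, u x <= v x) -> ulim u <= ulim v.
Proof.
move=> bu bv uv; rewrite -subr_ge0 -ulimB//; apply: ulim_ge.
  have [[M uM] [N vN]] := (bu, bv); exists (N + M) => x.
  by rewrite (le_trans (ler_normB _ _))// lerD.
by apply: filterS filterT => x _ /=; rewrite subr_ge0.
Qed.

Lemma ulim_norm u M : (forall x, `|u x| <= M) -> `|ulim u| <= M.
Proof.
move=> uM; have bu : bfun u by exists M.
rewrite ler_norml; apply/andP; split.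
  rewrite -(ulim_cst (- M)); apply: ulim_le => //; first by exists `|M| => _; rewrite normrN.
  by move=> x; have := uM x; rewrite ler_norml => /andP[].
rewrite -(ulim_cst M); apply: ulim_le => //; first by exists `|M|.
by move=> x; have := uM x; rewrite ler_norml => /andP[].
Qed.

(** The ultrafilter contains [A] or its complement, and the indicator is constant on either.
    Indicators of sets thus extend to indicators of clopen sets. *)
Lemma ulim_indic (A : set T) : ulim (\1_A) = \1_[set q : ultra T | q A] p.
Proof.
apply: ulim_eq; rewrite indicE; have [pA|pA] := boolP (_ \in _).
  apply: cvg_near_cst; rewrite inE /= in pA.
  by apply: filterS pA => x xA; rewrite indicE mem_set.
apply: cvg_near_cst; have /in_ultra_setVsetC := ultraP p => /(_ A)[pA'|].
  by move: pA; rewrite notin_setE.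
by apply: filterS => x xA; rewrite indicE memNset.
Qed.

End UltraLimit.

Lemma bfun_cst {R : realType} {T : Type} (c : R) : bfun (fun _ : T => c).
Proof. by exists `|c|. Qed.

Lemma bfunD {R : realType} {T : Type} (u v : T -> R) :
  bfun u -> bfun v -> bfun (fun x => u x + v x).
Proof.
by move=> [M uM] [N vN]; exists (M + N) => x; rewrite (le_trans (ler_normD _ _))// lerD.
Qed.

Lemma bfunM {R : realType} {T : Type} (u v : T -> R) :
  bfun u -> bfun v -> bfun (fun x => u x * v x).
Proof. by move=> [M uM] [N vN]; exists (M * N) => x; rewrite normrM ler_pM. Qed.

Lemma bfunZ {R : realType} {T : Type} c (u : T -> R) :
  bfun u -> bfun (fun x => c * u x).
Proof. by move=> bu; apply: bfunM => //; exact: bfun_cst. Qed.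

Lemma bfun_indic {R : realType} {T : Type} (A : set T) : bfun (\1_A : T -> R).
Proof. by exists 1 => x; rewrite indicE; case: (_ \in _); rewrite ?normr1 ?normr0. Qed.

Lemma bfun_sum {R : realType} {T : Type} (I : Type) (s : seq I) (P : pred I)
    (F : I -> T -> R) :
  (forall i, bfun (F i)) -> bfun (fun x => \sum_(i <- s | P i) F i x).
Proof.
move=> bF; rewrite (_ : (fun x => _) = \sum_(i <- s | P i) F i); last first.
  by apply/funext => x; rewrite fct_sumE.
elim/big_ind : _ => //; first exact: bfun_cst.
by move=> f g; exact: bfunD.
Qed.

Section UltraMeasurable.
Context {R : realType} {T : pointedType}.

Lemma measurable_ubasic (A : set T) : measurable (ubasic A : set (ultraM T)).
Proof. by apply: sub_sigma_algebra; exists A. Qed.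

(** A limit exceeds [r] strictly exactly when, for some [k], the values are at least
    [r + k.+1%:R^-1] on a set of the ultrafilter. So the superlevel sets are countable unions of
    basic sets. *)
Lemma bmeasurable_ulim (u : T -> R) : bfun u ->
  bmeasurable ((fun p => ulim p u) : ultraM T -> R).
Proof.
move=> bu; split; last first.
  by have [M uM] := bu; exists M => p; exact: ulim_norm.
move=> mD; apply: (measurability _ (RGenOInfty.measurableE R)) => //.
move=> /= _ [_ [r ->] <-]; rewrite setTI.
rewrite (_ : _ @^-1` _ = \bigcup_k ubasic [set x | r + k.+1%:R^-1 <= u x]).
  by apply: bigcup_measurable => k _; exact: measurable_ubasic.
apply/seteqP; split=> p /=; rewrite in_itv /= andbT.
  move=> rp; have := ultraP p => pU.
  have [k kr] : exists k, k.+1%:R^-1 < ulim p u - r.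
    by have [k] := ltr_add_invr rp; rewrite -ltrBDl => h; exists k.
  exists k => //; rewrite /ubasic /=.
  have up := ulim_cvg (p := p) bu.
  have /(_ _)/= := cvgr_gt (ulim p u) up.
  move=> /(_ (r + k.+1%:R^-1)); rewrite addrC -ltrBrDr => /(_ kr).
  by apply: filterS => x /ltW; rewrite addrC.
move=> [k _ pk]; rewrite (@lt_le_trans _ _ (r + k.+1%:R^-1))//.
  by rewrite ltrDl invr_gt0.
exact: ulim_ge.
Qed.

End UltraMeasurable.

(** * Means on bounded functions as integrals over ultrafilters *)

Record mean (R : realType) (T : Type) := Mean {
  mean_fun :> (T -> R) -> R;
  meanD : forall u v, bfun u -> bfun v ->
    mean_fun (fun x => u x + v x) = mean_fun u + mean_fun v;
  meanZ : forall c u, bfun u -> mean_fun (fun x => c * u x) = c * mean_fun u;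
  le_mean : forall u v, bfun u -> bfun v -> (forall x, u x <= v x) ->
    mean_fun u <= mean_fun v;
  mean_cst : forall c, mean_fun (fun=> c) = c
}.

(** The extension of [u] to the Stone-Cech compactification of [T]. *)
Definition uext {R : realType} {T : pointedType} (u : T -> R) : ultraM T -> R :=
  fun p => ulim p u.

Section MeanRepresentation.
Context {R : realType} {T : pointedType} (L : mean R T).
Implicit Types (u v : T -> R) (A B : set T).

Definition mean_set A : R := L \1_A.

Let mean_set_ge0 A : 0 <= mean_set A.
Proof.
rewrite -(mean_cst L 0); apply: le_mean; [exact: bfun_cst|exact: bfun_indic|].
by move=> x; rewrite indicE.
Qed.

Let mean_setT : mean_set setT = 1.
Proof. by rewrite /mean_set indicT mean_cst. Qed.

Let mean_setU A B : A `&` B = set0 ->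
  mean_set (A `|` B) = mean_set A + mean_set B.
Proof.
move=> AB; rewrite /mean_set -meanD; [|exact: bfun_indic..].
congr (L _); apply/funext => x; rewrite !indicE in_setU.
have [xA|_] := boolP (x \in A); have [xB|_] := boolP (x \in B);
  rewrite /= ?addr0 ?add0r//.
by have : x \in A `&` B; [rewrite in_setI xA xB|rewrite AB in_set0].
Qed.

Definition mean_finadd : finadd_prob R T := FinAddProb mean_set_ge0 mean_setT mean_setU.

Definition mean_prob : probability (ultraM T) R := umeasure mean_finadd.

Lemma mean_sum (I : Type) (s : seq I) (F : I -> T -> R) :
  (forall i, bfun (F i)) ->
  L (fun x => \sum_(i <- s) F i x) = \sum_(i <- s) L (F i).
Proof.
move=> bF; elim: s => [|i s IH].
  by under eq_fun do rewrite big_nil; rewrite mean_cst big_nil.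
under eq_fun do rewrite big_cons.
by rewrite meanD// ?IH ?big_cons//; exact: bfun_sum.
Qed.

Let bulim u : bfun u -> bmeasurable (uext u).
Proof. exact: bmeasurable_ulim. Qed.

Let repr_indic A : \int[mean_prob]_p uext \1_A p = L \1_A.
Proof.
rewrite /Rintegral (eq_integral (fun p : ultraM T => (\1_(ubasic A) p)%:E)); last first.
  by move=> p _; rewrite /uext ulim_indic.
rewrite integral_indic//; last exact: measurable_ubasic.
by rewrite setIT /= umeasureE.
Qed.

(** Stated for a multiple of a sum of indicators, the form of the layer-cake approximations used
    next. *)
Let repr_sum (s : seq (set T)) c :
  \int[mean_prob]_p uext (fun x => c * \sum_(A <- s) \1_A x) p =
  L (fun x => c * \sum_(A <- s) \1_A x).
Proof.
have bs : bfun (fun x => \sum_(A <- s) (\1_A x : R)).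
  by apply: bfun_sum => A; exact: bfun_indic.
rewrite meanZ// mean_sum; last by move=> A; exact: bfun_indic.
under eq_Rintegral do rewrite /uext ulimZ//.
rewrite bRintegralZ; last exact: bulim.
congr (_ * _); elim: s {bs} => [|A s IH].
  rewrite big_nil; under eq_Rintegral.
    by move=> p _; under [X in ulim _ X]eq_fun do rewrite big_nil; rewrite ulim_cst; over.
  by rewrite bRintegral_cst.
have bs : bfun (fun x => \sum_(A <- s) (\1_A x : R)).
  by apply: bfun_sum => B; exact: bfun_indic.
rewrite big_cons -IH -repr_indic -bRintegralD//; [|exact/bulim/bfun_indic|exact: bulim].
apply: eq_Rintegral => p _; rewrite -ulimD//; last exact: bfun_indic.
by congr (ulim _ _); apply/funext => x; rewrite big_cons.
Qed.

(* Layer-cake approximation of [u] by an average of [k.+1] indicators. *)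
Let layer u k : (forall x, 0 <= u x <= 1) -> exists s : seq (set T), forall x,
  k.+1%:R^-1 * \sum_(A <- s) \1_A x <= u x <=
  k.+1%:R^-1 * \sum_(A <- s) \1_A x + k.+1%:R^-1.
Proof.
move=> u01; set K : R := k.+1%:R; have K0 : 0 < K by rewrite ltr0n.
exists [seq [set x | i.+1%:R <= K * u x] | i <- iota 0 k.+1] => x.
have /andP[u0 u1] := u01 x; rewrite big_map.
have Ku0 : 0 <= K * u x by rewrite mulr_ge0// ltW.
have /andP[tl tu] := truncn_itv Ku0; set t := Num.truncn _ in tl tu.
have tk : (t <= k.+1)%N.
  by rewrite -(ler_nat R) (le_trans tl)// ler_piMr// ltW.
(* The point [x] lies in the level sets with [i < t] and in no others. Since [t <= k.+1], all of
   these occur in the list, and the sum counts them. *)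
have -> : \sum_(i <- iota 0 k.+1) (\1_[set x | i.+1%:R <= K * u x] x : R) = t%:R.
  rewrite (eq_bigr (fun i => ((i < t)%N)%:R)); last first.
    move=> i _; rewrite indicE; congr (_%:R); congr nat_of_bool.
    by apply/idP/idP; rewrite inE /= truncn_ge_nat.
  rewrite -natr_sum; congr (_%:R).
  rewrite -(subnKC tk) iotaD big_cat /= add0n.
  rewrite [X in (X + _)%N](_ : _ = t) ?[X in (_ + X)%N](_ : _ = 0%N) ?addn0//.
    rewrite big_seq big1// => i; rewrite mem_iota => /andP[ti _].
    by rewrite ltnNge ti.
  rewrite big_seq (eq_bigr (fun=> 1%N)); last first.
    by move=> i; rewrite mem_iota add0n => /= ->.
  by rewrite -big_seq big_const_seq count_predT size_iota iter_addn_0 mul1n.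
have -> : K^-1 * t%:R + K^-1 = K^-1 * t.+1%:R by rewrite -natr1 mulrDr mulr1.
by rewrite ler_pdivrMl// tl ler_pdivlMl// ltW.
Qed.

(** The mean and the integral agree on the layer-cake approximation [v]. Both are monotone, so at
    [u] each lies between this common value and the same value plus [k.+1%:R^-1]. *)
Lemma mean_representation01 u : (forall x, 0 <= u x <= 1) ->
  \int[mean_prob]_p uext u p = L u.
Proof.
move=> u01; have bu : bfun u.
  by exists 1 => x; have /andP[u0 u1] := u01 x; rewrite ger0_norm.
apply/eqP; rewrite -subr_eq0 -normr_eq0; apply/eqP/le_anti; rewrite normr_ge0 andbT.
apply/ler_addgt0Pr => e e0; rewrite add0r.
have [k ke] : exists k, k.+1%:R^-1 < e.
  by have [k] := ltr_add_invr e0; rewrite add0r => ke; exists k.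
apply: le_trans (ltW ke); have [s su] := layer k u01.
set v := fun x => k.+1%:R^-1 * \sum_(A <- s) (\1_A x : R).
have bv : bfun v by apply/bfunZ/bfun_sum => A; exact: bfun_indic.
have bvk : bfun (fun x => v x + k.+1%:R^-1) by apply: bfunD => //; exact: bfun_cst.
have Iv : \int[mean_prob]_p uext v p = L v := repr_sum _ _.
have lL : L v <= L u by apply: le_mean => // x; have /andP[] := su x.
have Lu : L u <= L v + k.+1%:R^-1.
  rewrite -[X in _ + X](mean_cst L) -meanD//; last exact: bfun_cst.
  by apply: le_mean => // x; have /andP[] := su x.
have lI : \int[mean_prob]_p uext v p <= \int[mean_prob]_p uext u p.
  apply: ble_Rintegral; [exact: bulim..|move=> p].
  by apply: ulim_le => // x; have /andP[] := su x.
have Iu : \int[mean_prob]_p uext u p <= \int[mean_prob]_p uext v p + k.+1%:R^-1.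
  have bc : bmeasurable (fun _ : ultraM T => k.+1%:R^-1 : R) by exact: bmeasurable_cst.
  rewrite -[X in _ + X](bRintegral_cst mean_prob) -(bRintegralD _ (bulim bv) bc).
  apply: ble_Rintegral; [exact: bulim|exact: (bmeasurableD (bulim bv) bc)|].
  move=> p; rewrite /uext -[X in _ + X](ulim_cst p) -ulimD//; last exact: bfun_cst.
  by apply: ulim_le => // x; have /andP[] := su x.
rewrite Iv in lI Iu; rewrite ler_norml; apply/andP; split.
  by rewrite lerNl opprB lerBlDr (le_trans Lu)// addrC lerD2l.
by rewrite lerBlDr (le_trans Iu)// addrC lerD2l.
Qed.

(** The affine change [u / (2 * K) + 1 / 2] brings [u] into [[0, 1]], and both sides respect it.
    Adding 1 to the bound keeps [K] positive. *)
Lemma mean_representation u : bfun u -> \int[mean_prob]_p uext u p = L u.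
Proof.
move=> bu; have [M uM] := bu.
pose K := `|M| + 1; have K0 : 0 < K by rewrite ltr_pwDr.
have uK x : `|u x| <= K by rewrite (le_trans (uM x))// (le_trans (ler_norm _))// lerDl.
pose v := fun x => (2 * K)^-1 * u x + 2^-1.
have v01 x : 0 <= v x <= 1.
  have : `|(2 * K)^-1 * u x| <= 2^-1.
    have K2 : 0 < 2 * K by rewrite mulr_gt0.
    rewrite normrM normfV (gtr0_norm K2) ler_pdivrMl//.
    by rewrite (le_trans (uK x))// mulrAC divff ?mul1r// pnatr_eq0.
  rewrite ler_norml /v => /andP[]; lra.
have bv : bfun (fun x => (2 * K)^-1 * u x) by exact: bfunZ.
have Ev : uext v = (fun p => (2 * K)^-1 * uext u p + 2^-1).
  by apply/funext => p; rewrite /uext ulimD ?ulim_cst ?ulimZ//; exact: bfun_cst.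
have := mean_representation01 v01.
rewrite /v meanD ?mean_cst ?meanZ//; last exact: bfun_cst.
rewrite Ev bRintegralD; [|apply: bmeasurableZ; exact: (bulim bu)|exact: bmeasurable_cst].
rewrite bRintegralZ ?bRintegral_cst; last exact: (bulim bu).
move/addIr; apply: mulfI.
by rewrite invr_eq0 mulf_neq0// ?pnatr_eq0// gt_eqF.
Qed.

End MeanRepresentation.

Local Close Scope classical_set_scope.

(** * Finite Fourier analysis *)

(** The polynomial [X^n - 1] splits and is separable in characteristic zero, so there are [n]
    distinct [n]-th roots of unity, and one of them is primitive. *)
Lemma closed_prim_root_exists (C : numClosedFieldType) n : (0 < n)%N ->
  exists z : C, n.-primitive_root z.
Proof.
pose p : {poly C} := 'X^n - 1; have [r Dp] := closed_field_poly_normal p.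
move=> n0; rewrite (monicP _) ?monicXnsubC // scale1r in Dp.
have rn1 : all n.-unity_root r by apply/allP=> z; rewrite -root_prod_XsubC -Dp.
have sz_r : (n < (size r).+1)%N.
  by rewrite -(size_prod_XsubC r id) -Dp size_XnsubC.
have [|z] := hasP (has_prim_root n0 rn1 _ sz_r); last by exists z.
by rewrite -separable_prod_XsubC -Dp separable_Xn_sub_1 // pnatr_eq0 -lt0n.
Qed.

Section FiniteFourier.
Variables (C : numClosedFieldType) (n m : nat) (w : C).
Hypothesis prim_w : m.+1.-primitive_root w.

Local Notation A := {ffun 'I_n -> 'I_m.+1}.
Implicit Types (j k l x : A).

(** The pairing that identifies [(Z/(m+1))^n] with its own dual: [j] indexes a character, evaluated
    at [k]. *)
Definition fchar j k : C := \prod_i w ^+ (j i * k i).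

Lemma fcharC j k : fchar j k = fchar k j.
Proof. by apply: eq_bigr => i _; rewrite mulnC. Qed.

Lemma fcharD j k l : fchar j (k + l) = fchar j k * fchar j l.
Proof.
rewrite -big_split; apply: eq_bigr => i _ /=.
rewrite ffunE /= !(mulnC (j i)) !exprM (prim_expr_mod prim_w).
by rewrite exprD exprMn.
Qed.

Lemma fchar0 j : fchar j 0 = 1.
Proof. by rewrite /fchar big1// => i _; rewrite ffunE muln0. Qed.

Lemma fchar_norm j k : `|fchar j k| = 1.
Proof.
rewrite normr_prod big1// => i _; rewrite normrX.
have : `|w| ^+ m.+1 = 1 by rewrite -normrX (prim_expr_order prim_w) normr1.
by move/eqP; rewrite pexprn_eq1// => /eqP ->; rewrite expr1n.
Qed.

Lemma fchar_conj j k : (fchar j k)^* = fchar j (- k).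
Proof.
have nz : fchar j k != 0 by rewrite -normr_eq0 fchar_norm oner_eq0.
by apply: (mulfI nz); rewrite -normCK fchar_norm expr1n -fcharD subrr fchar0.
Qed.

Definition basis (i : 'I_n) : A := [ffun i' => if i' == i then inord 1 else 0].

Lemma fchar_basis j i : (0 < m)%N -> fchar j (basis i) = w ^+ j i.
Proof.
move=> m0; rewrite /fchar (bigD1 i)//= big1 => [|i' ni]; rewrite ffunE.
  by rewrite eqxx inordK ?muln1 ?mulr1.
by rewrite (negbTE ni) muln0.
Qed.

(** Orthogonality of characters. If [k i != 0], shifting the summation index by [basis i] multiplies
    the sum by [w ^+ k i], which differs from 1 because [w] is primitive. *)
Lemma fchar_sum k : \sum_j fchar j k = if k == 0 then #|A|%:R else 0.
Proof.
case: eqP => [->|/eqP k0].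
  by under eq_bigr do rewrite fchar0; rewrite sumr_const.
have [i ki] : exists i, k i != 0.
  apply/existsP; apply: contraNT k0 => /existsPn k0.
  by apply/eqP/ffunP => i; rewrite ffunE; apply/eqP; have := k0 i; rewrite negbK.
have m0 : (0 < m)%N.
  by rewrite lt0n; apply: contraNneq ki => m0; move: (k i); rewrite m0 => i'; rewrite ord1.
set S := \sum_j _; have : S = fchar k (basis i) * S.
  rewrite {1}/S (reindex_inj (addrI (basis i))) mulr_sumr.
  by apply: eq_bigr => j _; rewrite fcharC fcharD fcharC (fcharC k) fcharC.
move=> /eqP; rewrite -subr_eq0 -{1}[S]mul1r -mulrBl mulf_eq0 => /orP[|/eqP//].
rewrite subr_eq0 eq_sym fchar_basis// -(prim_order_dvd prim_w) gtnNdvd ?ltn_ord//.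
by rewrite lt0n.
Qed.

Variable K : A -> A -> C.

(** For a kernel [K k l = phi (k - l)] this is the normalized Fourier transform of [phi]. Written as
    a quadratic form it is visibly nonnegative for positive definite kernels, and it makes sense for
    kernels that are not translation invariant. *)
Definition weight j : C :=
  #|A|%:R ^- 2 * \sum_k \sum_l (fchar j k)^* * fchar j l * K k l.

(** Fourier inversion. After exchanging the sums, orthogonality keeps only the pairs with
    [k = l + x], which leaves an average of the kernel along the translation by [x]. *)
Lemma weight_sum x :
  \sum_j weight j * fchar j x = #|A|%:R^-1 * \sum_(l : A) K (l + x) l.
Proof.
have A0 : #|A|%:R != 0 :> C.
  by rewrite pnatr_eq0 -lt0n; apply/card_gt0P; exists 0.
have -> : \sum_j weight j * fchar j x =
    #|A|%:R ^- 2 * \sum_(k : A) \sum_(l : A) (\sum_j fchar j (x + l - k)) * K k l.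
  under eq_bigr do rewrite /weight -mulrA; rewrite -mulr_sumr; congr (_ * _).
  under eq_bigr do rewrite mulr_suml; rewrite exchange_big; apply: eq_bigr => k _ /=.
  under eq_bigr do rewrite mulr_suml; rewrite exchange_big; apply: eq_bigr => l _ /=.
  rewrite mulr_suml; apply: eq_bigr => j _; rewrite fchar_conj !fcharD.
  by rewrite mulrAC; congr (_ * _); rewrite mulrC mulrCA mulrC.
under eq_bigr do under eq_bigr do rewrite fchar_sum.
rewrite exchange_big /= mulr_sumr [RHS]mulr_sumr; apply: eq_bigr => l _.
rewrite (bigD1 (l + x))//= big1 ?addr0 => [|k kl].
  by rewrite (addrC x) subrr eqxx mulrA expr2 invfM mulfVK.
by rewrite subr_eq0 eq_sym addrC (negbTE kl) mul0r.
Qed.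

End FiniteFourier.

(** * Almost homomorphisms from finite groups to [G] *)

Section Defect.
Variables (n m : nat) (G : zmodType).
Local Notation A := {ffun 'I_n -> 'I_m.+1}.
Variable a : A -> G.
Implicit Types (x y l : A) (g h : G).

(* Number of points at which [a] fails to intertwine the translation by [x] with
   the translation by [g], because of wrap-around modulo [m.+1]. *)
Definition defect x g : nat := #|[set l : A | a (l + x) != a l + g]|.

(** If [x] succeeds at [l] and [y] succeeds at [l + x], then [x + y] succeeds at [l]. Translation by
    [x] does not change the number of failures of [y], so a union bound applies. *)
Lemma defectD x y g h : (defect (x + y)%R (g + h)%R <= defect x g + defect y h)%N.
Proof.
have -> : defect y h = #|[set l : A | a (l + x + y) != a (l + x) + h]|.
  rewrite /defect -(card_preimset _ (addIr x)).
  by apply: eq_card => l; rewrite !inE.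
apply: leq_trans (leq_card_setU _ _); apply: subset_leq_card.
apply/fintype.subsetP => l; rewrite !inE; apply: contraR; rewrite negb_or !negbK.
by move=> /andP[/eqP h1 /eqP h2]; rewrite !addrA h2 h1.
Qed.

(** Success of [x] at [l - x] gives success of [- x] at [l], and translation preserves
    cardinality. *)
Lemma defectN x g : (defect (- x)%R (- g)%R <= defect x g)%N.
Proof.
have -> : defect x g = #|[set l : A | a (l - x + x) != a (l - x) + g]|.
  rewrite /defect -(card_preimset _ (addIr (- x))).
  by apply: eq_card => l; rewrite !inE.
apply: subset_leq_card; apply/fintype.subsetP => l; rewrite !inE subrK.
by apply: contra => /eqP ->; rewrite addrK.
Qed.

End Defect.

Section Lift.
Variables (G : zmodType) (gamma : nat -> G) (n m : nat).
Local Notation A := {ffun 'I_n -> 'I_m.+1}.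

(** Residues are read as their representatives below [m.+1], so the map is additive only up to
    wrap-around. *)
Definition lift_sum (k : A) : G := \sum_(i < n) gamma i *+ k i.

(** Adding 1 to the [i]-th coordinate wraps around only at the value [ord_max]. All values of this
    coordinate are equally frequent, so failures make up at most a fraction [1 / (m + 1)] of the
    group. *)
Lemma defect_basis i : (0 < m)%N ->
  (defect lift_sum (basis m i) (gamma i) * m.+1 <= #|A|)%N.
Proof.
move=> m0.
have cardT (t : 'I_m.+1) :
    #|[set l : A | l i == t]| = #|[set l : A | l i == ord_max]|.
  pose s : A := [ffun i' => if i' == i then ord_max - t else 0].
  rewrite -[RHS](card_preimset _ (addIr s)); apply: eq_card => l; rewrite !inE.
  by rewrite ffunE /s ffunE eqxx addrCA -[X in _ = (_ == X)]addr0 (inj_eq (addrI _)) subr_eq0.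
have -> : #|A| = (#|[set l : A | l i == ord_max]| * m.+1)%N.
  rewrite -[LHS]sum1_card (partition_big (fun l : A => l i) predT)//=.
  rewrite (eq_bigr (fun=> #|[set l : A | l i == ord_max]|)); last first.
    by move=> t _; rewrite -(cardT t) -sum1_card; apply: eq_bigl => l; rewrite !inE.
  by rewrite sum_nat_const card_ord mulnC.
rewrite leq_mul2r /=; apply: subset_leq_card; apply/fintype.subsetP => l; rewrite !inE.
apply: contraR => li; apply/eqP; rewrite /lift_sum.
rewrite (bigD1 i)//= [in RHS](bigD1 i)//= addrAC.
congr (_ + _).
  rewrite ffunE /= /basis ffunE eqxx inordK// modn_small; last first.
    rewrite addn1 ltnS; have := ltn_ord (l i); rewrite ltnS leq_eqVlt.
    by case/orP => // /eqP h; case/eqP : li; apply/val_inj.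
  by rewrite addn1 mulrSr.
apply: eq_bigr => i' ni; rewrite ffunE /= /basis ffunE (negbTE ni) addn0.
by rewrite modn_small.
Qed.

End Lift.

Local Open Scope classical_set_scope.

(** * Borel sets of the complex plane and of the dual group *)

Section Boxes.
Context {R : realType} {X : Type} (phi : nat -> X -> R).

(* The radius is half of the one in [box_open], so that a box meeting a point may
   be recentered at that point. *)
Definition rat_box (nq : nat * seq rat) : set X :=
  [set y | forall i, (i < nq.1)%N ->
    `|phi i y - ratr (nth 0 nq.2 i)| < (2 * nq.1.+1%:R)^-1].

(** Openness for the topology generated by the coordinates [phi]; a single [n] controls both the
    number of coordinates and the radius. *)
Definition box_open (U : set X) := forall x, U x -> exists n, forall y,
  (forall i, (i < n)%N -> `|phi i y - phi i x| < n.+1%:R^-1) -> U y.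

Lemma box_openE U : box_open U ->
  U = \bigcup_(nq in [set nq | rat_box nq `<=` U]) rat_box nq.
Proof.
move=> oU; apply/seteqP; split=> [x Ux|x [nq /= sub]]; last exact: sub.
have [n nP] := oU x Ux.
have /choice[q qP] i : exists q : rat, `|phi i x - ratr q| < (2 * n.+1%:R)^-1.
  have : 0 < (2 * n.+1%:R)^-1 :> R by rewrite invr_gt0 mulr_gt0.
  move: _^-1 => e e0; have : phi i x - e < phi i x + e by lra.
  move=> /rat_in_itvoo[q]; rewrite in_itv /= => /andP[q1 q2].
  by exists q; rewrite ltr_norml; apply/andP; split; lra.
have nthq i : (i < n)%N -> nth 0 (mkseq q n) i = q i by move=> ?; rewrite nth_mkseq.
exists (n, mkseq q n); last by move=> i /= iN; rewrite nthq.
move=> y /= yP; apply: nP => i iN; have := yP i iN; rewrite nthq// => yq.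
rewrite -(subrKA (ratr (q i))) (le_lt_trans (ler_normD _ _))//.
have -> : n.+1%:R^-1 = (2 * n.+1%:R)^-1 + (2 * n.+1%:R)^-1 :> R.
  by rewrite invfM -mulrDl [2^-1 + _](_ : _ = 1) ?mul1r//; lra.
by rewrite ltrD// distrC.
Qed.

(** There are only countably many rational boxes, and the preimage of each is a finite intersection
    of preimages of intervals. Measurability is thereby reduced to the coordinates. *)
Lemma box_open_preimage {d} {Y : measurableType d} (f : Y -> X) (U : set X) :
  (forall i, measurable_fun [set: Y] (phi i \o f)) -> box_open U ->
  measurable (f @^-1` U).
Proof.
move=> mf /box_openE ->; rewrite preimage_bigcup.
rewrite bigcup_mkcond; apply: countable_bigcupT_measurable.
  exact: countableP.
move=> [n q]; case: ifPn => // _.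
set e := (2 * n.+1%:R)^-1 : R.
rewrite (_ : _ @^-1` _ = \bigcap_(i in `I_n)
    ((phi i \o f) @^-1` `]ratr (nth 0 q i) - e, ratr (nth 0 q i) + e[)).
  apply: bigcap_measurableType => i _; rewrite -[X in measurable X]setTI.
  by apply: mf => //; exact: measurable_itv.
apply/seteqP; split=> y /= yP i iN; have := yP i iN;
  by rewrite /= in_itv /= ltr_distl.
Qed.

End Boxes.

Section ComplexTopology.
Context {R : realType}.
Implicit Types (z w : R[i]) (U : set R[i]).

Lemma ltcR_norm z (e : R) : (`|z| < e%:C%C) = (Normc.normc z < e).
Proof. by rewrite -ltcR. Qed.

Lemma normc_Re z : `|complex.Re z| <= Normc.normc z.
Proof.
case: z => a b /=; rewrite -sqrtr_sqr ler_sqrt ?lerDl ?sqr_ge0//.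
by rewrite addr_ge0 ?sqr_ge0.
Qed.

Lemma normc_Im z : `|complex.Im z| <= Normc.normc z.
Proof.
case: z => a b /=; rewrite -sqrtr_sqr ler_sqrt ?lerDr ?sqr_ge0//.
by rewrite addr_ge0 ?sqr_ge0.
Qed.

Lemma norm1_normc z : `|z| = 1 -> Normc.normc z = 1.
Proof. by move/(congr1 (@complex.Re R)). Qed.

(** Allows an equation between unimodular numbers to be tested on a real part, both for the trivial
    character and for almost sure multiplicativity. *)
Lemma norm1_Re1 z : `|z| = 1 -> Re z = 1 -> z = 1.
Proof.
move=> /norm1_normc; case: z => a b /= + a1; rewrite a1 => /(congr1 (fun x => x ^+ 2)).
rewrite sqr_sqrtr ?addr_ge0 ?sqr_ge0// expr1n => b0.
have /eqP : b ^+ 2 = 0 by lra.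
by rewrite sqrf_eq0 => /eqP ->.
Qed.

Lemma norm1_Re_le1 z : `|z| = 1 -> Re z <= 1.
Proof. by move=> /norm1_normc <-; exact: le_trans (ler_norm _) (normc_Re _). Qed.

Lemma normc_ReIm z : Normc.normc z <= `|complex.Re z| + `|complex.Im z|.
Proof.
case: z => a b /=; rewrite -[leRHS]ger0_norm ?addr_ge0// -sqrtr_sqr ler_wsqrtr//.
rewrite sqrrD !real_normK ?num_real// addrAC lerDl.
by rewrite mulrn_wge0 ?mulr_ge0.
Qed.

Lemma ReD z w : complex.Re (z + w) = complex.Re z + complex.Re w.
Proof. by case: z w => a b [c e]. Qed.

Lemma ImD z w : complex.Im (z + w) = complex.Im z + complex.Im w.
Proof. by case: z w => a b [c e]. Qed.

Lemma ReB z w : complex.Re (z - w) = complex.Re z - complex.Re w.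
Proof. by case: z w => a b [c e]. Qed.

Lemma ImB z w : complex.Im (z - w) = complex.Im z - complex.Im w.
Proof. by case: z w => a b [c e]. Qed.

Lemma ReM z w : complex.Re (z * w) =
  complex.Re z * complex.Re w - complex.Im z * complex.Im w.
Proof. by case: z w => a b [c e]. Qed.

Lemma ImM z w : complex.Im (z * w) =
  complex.Re z * complex.Im w + complex.Im z * complex.Re w.
Proof. by case: z w => a b [c e]. Qed.

Lemma complex_ext z w :
  complex.Re z = complex.Re w -> complex.Im z = complex.Im w -> z = w.
Proof. by case: z w => a b [c e] /= -> ->. Qed.

Lemma open_complexP (U : set R[i]^o) z : open U -> U z -> exists2 e : R, 0 < e &
  forall w, `|complex.Re w - complex.Re z| < e ->
    `|complex.Im w - complex.Im z| < e -> U w.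
Proof.
move=> oU Uz; have /nbhs_ballP[e /= e0 eU] : nbhs (z : R[i]^o) U by exact: open_nbhs_nbhs.
(* Radii of balls in [R[i]^o] are elements of [R[i]]; a positive one is real. *)
have er : e = (complex.Re e)%:C%C by rewrite RRe_real// gtr0_real.
have e0' : 0 < complex.Re e by rewrite -ltcR -er.
exists (complex.Re e / 2) => [|w wRe wIm]; first by rewrite divr_gt0.
apply: eU; rewrite -ball_normE /= distrC er ltcR_norm.
rewrite (le_lt_trans (normc_ReIm _))// [ltRHS](splitr (complex.Re e)).
by rewrite ReB ImB ltrD.
Qed.

Lemma continuous_Re : continuous (@complex.Re R : R[i]^o -> R).
Proof.
move=> z; apply: (proj2 (@cvgrPdist_lt R R _ (nbhs (z : R[i]^o)) (nbhs_filter _)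
  (@complex.Re R) _)).
move=> e e0.
have : nbhs (z : R[i]^o) (ball (z : R[i]^o) e%:C%C).
  by apply: nbhsx_ballx; rewrite ltcR.
apply: (@filterS _ _ (nbhs_filter (z : R[i]^o))).
move=> w; rewrite -ball_normE /= ltcR_norm -ReB => zw.
exact: le_lt_trans (normc_Re _) zw.
Qed.

Lemma continuous_Im : continuous (@complex.Im R : R[i]^o -> R).
Proof.
move=> z; apply: (proj2 (@cvgrPdist_lt R R _ (nbhs (z : R[i]^o)) (nbhs_filter _)
  (@complex.Im R) _)).
move=> e e0.
have : nbhs (z : R[i]^o) (ball (z : R[i]^o) e%:C%C).
  by apply: nbhsx_ballx; rewrite ltcR.
apply: (@filterS _ _ (nbhs_filter (z : R[i]^o))).
move=> w; rewrite -ball_normE /= ltcR_norm -ImB => zw.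
exact: le_lt_trans (normc_Im _) zw.
Qed.

Lemma cvg_complex {T : Type} (F : set_system T) {FF : Filter F} (f : T -> R[i]) z :
  complex.Re (f x) @[x --> F] --> complex.Re z ->
  complex.Im (f x) @[x --> F] --> complex.Im z ->
  f x @[x --> F] --> (z : R[i]^o).
Proof.
move=> cRe cIm U; rewrite nbhsE => -[V [oV Vz] VU].
have [e e0 eV] := open_complexP oV Vz.
have hR := (cvgrPdist_lt _ _).1 cRe e e0.
have hI := (cvgrPdist_lt _ _).1 cIm e e0.
suff : \forall x \near F, U (f x) by [].
near=> x; apply/VU/eV; rewrite distrC; near: x; [exact: hR|exact: hI].
Unshelve. all: by end_near. Qed.

End ComplexTopology.

Lemma continuous_measurable_borel {R : realType} (T : ptopologicalType)
    (phi : T -> R) :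
  continuous phi -> measurable_fun setT (phi : g_sigma_algebraType (@open T) -> R).
Proof.
move=> /continuousP cphi mD; apply: (measurability _ (RGenOInfty.measurableE R)) => //.
move=> /= _ [_ [r ->] <-]; rewrite setTI; apply: sub_sigma_algebra.
by apply: cphi; exact: rray_open.
Qed.

Section BorelC.
Context {R : realType} {d : measure_display} {Y : measurableType d}.

Lemma measurable_Re : measurable_fun setT (@complex.Re R : borelC R -> R).
Proof. exact: (continuous_measurable_borel (@continuous_Re R)). Qed.

Lemma measurable_Im : measurable_fun setT (@complex.Im R : borelC R -> R).
Proof. exact: (continuous_measurable_borel (@continuous_Im R)). Qed.

Lemma measurable_fun_borelC (f : Y -> R[i]) :
  measurable_fun setT (fun y => complex.Re (f y)) ->
  measurable_fun setT (fun y => complex.Im (f y)) ->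
  measurable_fun setT (f : Y -> borelC R).
Proof.
move=> mRe mIm; apply: (@measurability _ _ Y (borelC R) setT f (@open R[i]^o)) => //.
move=> _ [U oU <-]; rewrite setTI.
apply: (@box_open_preimage R _ (fun i => if i is 0%N then @complex.Re R else @complex.Im R)).
  by case.
move=> z Uz; have [e e0 eU] := open_complexP oU Uz.
have [k ke] : exists k, k.+1%:R^-1 < e.
  by have [k] := ltr_add_invr e0; rewrite add0r => ke; exists k.
(* The index [k.+2] ensures that a box constrains coordinates 0 and 1, the real and the imaginary
   part; its radius is then [k.+3%:R^-1]. *)
have ke' : k.+3%:R^-1 < e.
  apply: le_lt_trans ke; rewrite lef_pV2 ?posrE// ler_nat.
  exact: leqW (leqnSn _).
exists k.+2 => w wz; apply: eU; rewrite (lt_trans _ ke')//.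
  by have := wz 0%N; apply.
by have := wz 1%N; apply.
Qed.

End BorelC.

Lemma cvg_ptws {I : eqType} {V : topologicalType} (F : set_system (I -> V))
    {FF : Filter F} (f : I -> V) :
  (forall i, g i @[g --> F] --> f i) -> F --> (f : {ptws I -> V}).
Proof.
move=> Ff; apply/cvg_sup => i; apply/cvg_image.
  by apply/seteqP; split => v // _; exists (fun=> v).
move=> W /Ff FW; exists (@proj I (fun=> V) i @^-1` W) => //.
by apply/seteqP; split => [_ [g + <-]//|v Wv]; exists (fun=> v).
Qed.

Section DualTopology.
Context {R : realType} {G : zmodType}.

Lemma eq_dual (chi psi : dual R G) : (forall g, chi g = psi g) -> chi = psi.
Proof.
case: chi psi => [f fD fn] [f' f'D f'n] /= ff'.
have {}ff' : f = f' by apply/funext.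
by subst f'; congr Character; exact: Prop_irrelevance.
Qed.

Definition ev (g : G) (chi : dual R G) : R[i] := chi g.

Lemma continuous_ev g : continuous (ev g : dual R G -> R[i]^o).
Proof.
move=> chi; apply: (@continuous_comp (dual R G) {ptws G -> R[i]^o} R[i]^o
  (fun psi => psi : {ptws G -> R[i]^o}) (proj g)).
  exact: (@initial_continuous _ _ (fun psi : dual R G => (psi : {ptws G -> R[i]^o}))).
exact: (@proj_continuous G (fun=> R[i]^o) g).
Qed.

Lemma measurable_ev_Re g :
  measurable_fun setT ((fun chi => complex.Re (chi g)) : borel_dual R G -> R).
Proof.
apply: (@continuous_measurable_borel _ (dual R G)).
move=> chi.
exact: (@continuous_comp (dual R G) R[i]^o R (ev g) (@complex.Re R) chi
  (@continuous_ev g chi) (@continuous_Re R _)).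
Qed.

Lemma measurable_ev_Im g :
  measurable_fun setT ((fun chi => complex.Im (chi g)) : borel_dual R G -> R).
Proof.
apply: (@continuous_measurable_borel _ (dual R G)).
move=> chi.
exact: (@continuous_comp (dual R G) R[i]^o R (ev g) (@complex.Im R) chi
  (@continuous_ev g chi) (@continuous_Im R _)).
Qed.

Variable (gamma : nat -> G) (gamma_surj : forall g, exists n, gamma n = g).

(** Real and imaginary parts at the enumerated elements, interleaved into the single sequence of
    real coordinates that [box_open] expects. *)
Definition dual_coord (i : nat) (chi : dual R G) : R :=
  if odd i then complex.Im (chi (gamma i./2)) else complex.Re (chi (gamma i./2)).

(** Otherwise each box around [chi] contains some [psi n] outside [U]. These characters converge to
    [chi] at every enumerated element, hence pointwise, so they must enter [U]. *)
Lemma box_open_dual (U : set (dual R G)) : open U -> box_open dual_coord U.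
Proof.
move=> oU chi Uchi; apply: contrapT => /forallNP noN.
have /choice[psi psiP] n : exists psi : dual R G,
    (forall i, (i < n)%N -> `|dual_coord i psi - dual_coord i chi| < n.+1%:R^-1) /\
    ~ U psi.
  have /existsNP[psi /not_implyP[? ?]] := noN n; by exists psi.
have cvg_coord i : dual_coord i (psi n) @[n --> \oo] --> dual_coord i chi.
  apply/cvgrPdist_lt => e e0; near=> n.
  have iN : (i < n)%N by near: n; exact: nbhs_infty_gt.
  rewrite distrC (lt_trans ((psiP n).1 i iN))//.
  near: n; have [k] := ltr_add_invr e0; rewrite add0r => ke; exists k => // n /= kn.
  by rewrite (le_lt_trans _ ke)// lef_pV2 ?posrE// ler_nat ltnS.
have cpsi : ((fun n => psi n : {ptws G -> R[i]^o}) @ \oo) --> (chi : {ptws G -> R[i]^o}).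
  apply: cvg_ptws => g; have [k kg] := gamma_surj g.
  apply: cvg_complex.
    by have := cvg_coord k.*2; rewrite /dual_coord odd_double doubleK kg.
  by have := cvg_coord k.*2.+1; rewrite /dual_coord /= odd_double /= uphalf_double kg.
have [V [oV VU]] : exists V : set {ptws G -> R[i]^o}, open V /\
    (fun psi : dual R G => (psi : {ptws G -> R[i]^o})) @^-1` V = U.
  by have [V oV VU] := oU; exists V.
have : nbhs (chi : {ptws G -> R[i]^o}) V.
  by apply: open_nbhs_nbhs; split => //; rewrite -VU in Uchi.
move=> /cpsi[N _ /(_ N (leqnn N))] /= VN.
by apply: (psiP N).2; rewrite -VU.
Unshelve. all: by end_near. Qed.

Lemma measurable_fun_dual d (Y : measurableType d) (f : Y -> dual R G) :
  (forall g, measurable_fun setT (fun y => complex.Re (f y g))) ->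
  (forall g, measurable_fun setT (fun y => complex.Im (f y g))) ->
  measurable_fun setT (f : Y -> borel_dual R G).
Proof.
move=> mRe mIm; apply: (@measurability _ _ Y (borel_dual R G) setT f (@open (dual R G))) => //.
move=> _ [U oU <-]; rewrite setTI.
apply: (@box_open_preimage R _ dual_coord); last exact: box_open_dual.
by move=> i; rewrite /dual_coord /comp; case: odd.
Qed.

(** A unimodular value with real part 1 equals 1, so triviality amounts to countably many measurable
    conditions. *)
Lemma measurable_dual1 : measurable ([set dual1] : set (borel_dual R G)).
Proof.
rewrite (_ : [set dual1] = \bigcap_n
  (((fun chi => complex.Re (chi (gamma n))) : borel_dual R G -> R) @^-1` [set 1])).
  apply: bigcap_measurableType => n _; rewrite -[X in measurable X]setTI.
  by apply: measurable_ev_Re => //; exact: measurable_set1.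
apply/seteqP; split=> [_ -> n _ //|chi chi1].
apply: eq_dual => g; have [n <-] := gamma_surj g.
exact: (norm1_Re1 (char_norm chi _) (chi1 n I)).
Qed.

End DualTopology.

(** * Almost everywhere equality and image measures *)

Section AlmostEverywhere.
Context {d : measure_display} {X : measurableType d} {R : realType}.
Variable mu : probability X R.
Implicit Types (f g : X -> R) (E : set X).

Lemma Rintegral_ae E f g : measurable E -> mu (~` E) = 0%E ->
  measurable_fun setT f -> measurable_fun setT g -> (forall x, E x -> f x = g x) ->
  \int[mu]_x f x = \int[mu]_x g x.
Proof.
move=> mE E0 mf mg fg; rewrite /Rintegral; congr fine.
apply: ae_eq_integral => //; [exact/measurable_EFinP..|].
exists (~` E); split => //; first exact: measurableC.
by move=> x /= /not_implyP[_ nfg] Ex; apply: nfg; rewrite fg.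
Qed.

Lemma Rintegral0_null f : bmeasurable f -> (forall x, 0 <= f x) ->
  \int[mu]_x f x = 0 -> mu [set x | f x != 0] = 0%E.
Proof.
move=> bf f0 If; have [mf _] := bf.
have If0 : (\int[mu]_x `|(f x)%:E| = 0)%E.
  rewrite (eq_integral (EFin \o f)) => [|x _]; last by rewrite /= ger0_norm.
  by rewrite -[LHS]fineK; [rewrite -/(Rintegral _ _ _) If|
    exact/integrable_fin_num/bmeasurable_integrable].
have /(ae_eq_integral_abs mu measurableT)[+ _] : measurable_fun setT (EFin \o f).
  exact/measurable_EFinP.
move=> /(_ If0)[N [mN N0 Nf]]; apply: (subset_measure0 _ mN) => //.
  rewrite (_ : [set x | _] = f @^-1` (~` [set 0])).
    by rewrite -[X in measurable X]setTI; apply: mf => //; exact: measurableC.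
  by apply/seteqP; split=> x /= /eqP.
by move=> x /= fx; apply: Nf => /= /(_ I)[/eqP]; rewrite (negbTE fx).
Qed.

Lemma pushforward_probability {d'} {Y : measurableType d'} (f : X -> Y) :
  measurable_fun setT f -> exists nu : probability Y R,
    (forall A, nu A = mu (f @^-1` A)) /\
    forall u : Y -> R, bmeasurable u -> \int[nu]_y u y = \int[mu]_x u (f x).
Proof.
move=> mf; pose F : {mfun X >-> Y} := HB.pack f (isMeasurableFun.Build _ _ _ _ f mf).
exists (distribution mu F); split=> // u bu; rewrite /Rintegral integral_distribution//.
  by have [mu' _] := bu; exact/measurable_EFinP.
apply: (@bmeasurable_integrable _ _ _ mu (fun x => u (f x))).
have [mu' [M uM]] := bu; split; last by exists M => x.
exact: measurableT_comp.
Qed.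

End AlmostEverywhere.

(** * Complex integration of bounded functions *)

Section ComplexIntegral.
Context {d : measure_display} {X : measurableType d} {R : realType}.
Implicit Types (f g : X -> R[i]).

Definition cbmeasurable f :=
  bmeasurable (fun x => Re (f x)) /\ bmeasurable (fun x => Im (f x)).

Lemma cbmeasurable_cst (c : R[i]) : cbmeasurable (fun=> c).
Proof. by split; exact: bmeasurable_cst. Qed.

Lemma cbmeasurableD f g : cbmeasurable f -> cbmeasurable g ->
  cbmeasurable (fun x => f x + g x).
Proof.
move=> [fR fI] [gR gI]; split; [under eq_fun do rewrite ReD|under eq_fun do rewrite ImD];
  exact: bmeasurableD.
Qed.

Lemma cbmeasurableM f g : cbmeasurable f -> cbmeasurable g ->
  cbmeasurable (fun x => f x * g x).
Proof.
move=> [fR fI] [gR gI]; split; [under eq_fun do rewrite ReM|under eq_fun do rewrite ImM].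
  by apply: bmeasurableB; exact: bmeasurableM.
by apply: bmeasurableD; exact: bmeasurableM.
Qed.

Lemma cbmeasurable_conj f : cbmeasurable f -> cbmeasurable (fun x => conjc (f x)).
Proof.
move=> [fR fI]; split.
  rewrite (_ : (fun x => _) = fun x => Re (f x))//.
  by apply/funext => x; case: (f x).
rewrite (_ : (fun x => _) = fun x => - Im (f x)); first exact: bmeasurableN.
by apply/funext => x; case: (f x).
Qed.

Lemma cbmeasurable_sum (I : Type) (s : seq I) (P : pred I) (F : I -> X -> R[i]) :
  (forall i, cbmeasurable (F i)) -> cbmeasurable (fun x => \sum_(i <- s | P i) F i x).
Proof.
move=> bF; rewrite (_ : (fun x => _) = \sum_(i <- s | P i) F i); last first.
  by apply/funext => x; rewrite fct_sumE.
elim/big_ind : _ => //; first exact: cbmeasurable_cst.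
by move=> f g; exact: cbmeasurableD.
Qed.

Variable mu : probability X R.

Lemma cintegralD f g : cbmeasurable f -> cbmeasurable g ->
  cintegral mu (fun x => f x + g x) = cintegral mu f + cintegral mu g.
Proof.
move=> [fR fI] [gR gI]; apply: complex_ext; rewrite ?ReD ?ImD /= -bRintegralD//;
  by apply: eq_Rintegral => x _; rewrite ?ReD ?ImD.
Qed.

Lemma cintegralZ c f : cbmeasurable f ->
  cintegral mu (fun x => c * f x) = c * cintegral mu f.
Proof.
move=> [fR fI]; apply: complex_ext; rewrite ?ReM ?ImM /= -!bRintegralZ//.
  rewrite -bRintegralB; [|exact: bmeasurableZ..].
  by apply: eq_Rintegral => x _; rewrite ReM.
rewrite -bRintegralD; [|exact: bmeasurableZ..].
by apply: eq_Rintegral => x _; rewrite ImM.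
Qed.

Lemma cintegral_cst (c : R[i]) : cintegral mu (fun=> c) = c.
Proof. by apply: complex_ext; rewrite /= bRintegral_cst. Qed.

Lemma cintegral_sum (I : Type) (s : seq I) (F : I -> X -> R[i]) :
  (forall i, cbmeasurable (F i)) ->
  cintegral mu (fun x => \sum_(i <- s) F i x) = \sum_(i <- s) cintegral mu (F i).
Proof.
move=> bF; elim: s => [|i s IH].
  by under eq_fun do rewrite big_nil; rewrite cintegral_cst big_nil.
under eq_fun do rewrite big_cons.
by rewrite cintegralD ?IH ?big_cons//; exact: cbmeasurable_sum.
Qed.

Lemma cintegral_conj f : cbmeasurable f ->
  cintegral mu (fun x => conjc (f x)) = conjc (cintegral mu f).
Proof.
move=> [fR fI]; apply: complex_ext => /=.
  by apply: eq_Rintegral => x _; case: (f x).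
rewrite -[RHS]mulN1r -bRintegralZ//.
by apply: eq_Rintegral => x _; rewrite mulN1r; case: (f x).
Qed.

Lemma cintegral_ge0 f : (forall x, 0 <= f x) -> 0 <= cintegral mu f.
Proof.
(* In the order of [R[i]], [0 <= z] also asserts that the imaginary part vanishes. *)
move=> f0; rewrite lecE /=; apply/andP; split.
  rewrite (eq_Rintegral _ (g := fun=> 0)) ?bRintegral_cst// => x _.
  exact: ger0_Im.
apply: Rintegral_ge0 => x _; have := f0 x; rewrite lecE => /andP[_].
exact.
Qed.

Lemma cintegral_ae E f g : measurable E -> mu (~` E) = 0%E ->
  measurable_fun setT (f : X -> borelC R) ->
  measurable_fun setT (g : X -> borelC R) ->
  (forall x, E x -> f x = g x) -> cintegral mu f = cintegral mu g.
Proof.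
move=> mE E0 mf mg fg; apply: complex_ext => /=;
  apply: (Rintegral_ae mE E0) => [||x Ex]; rewrite ?fg//.
- exact: (measurableT_comp measurable_Re mf).
- exact: (measurableT_comp measurable_Re mg).
- exact: (measurableT_comp measurable_Im mf).
- exact: (measurableT_comp measurable_Im mg).
Qed.

Lemma cbmeasurable_borelC f : cbmeasurable f ->
  measurable_fun setT (f : X -> borelC R).
Proof. by move=> [[? _] [? _]]; exact: measurable_fun_borelC. Qed.

Lemma measurable_borelCM f g : measurable_fun setT (f : X -> borelC R) ->
  measurable_fun setT (g : X -> borelC R) ->
  measurable_fun setT ((fun x => f x * g x) : X -> borelC R).
Proof.
move=> mf mg.
have fR := measurableT_comp measurable_Re mf; have fI := measurableT_comp measurable_Im mf.
have gR := measurableT_comp measurable_Re mg; have gI := measurableT_comp measurable_Im mg.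
apply: measurable_fun_borelC; [under eq_fun do rewrite ReM|under eq_fun do rewrite ImM].
  by apply: measurable_funB; exact: measurable_funM.
by apply: measurable_funD; exact: measurable_funM.
Qed.

Lemma measurable_borelC_conj f : measurable_fun setT (f : X -> borelC R) ->
  measurable_fun setT ((fun x => conjc (f x)) : X -> borelC R).
Proof.
move=> mf; apply: measurable_fun_borelC.
  rewrite (_ : (fun x => _) = fun x => Re (f x)).
    exact: (measurableT_comp measurable_Re mf).
  by apply/funext => x; case: (f x).
rewrite (_ : (fun x => _) = fun x => - Im (f x)).
  exact/measurable_funN/(measurableT_comp measurable_Im mf).
by apply/funext => x; case: (f x).
Qed.

End ComplexIntegral.

(** * Bochner's theorem *)

(** The points [g i] may repeat, so the condition pulls back along maps such as [lift_sum] that are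
    not injective. *)
Definition positive_definite {R : realType} {G : zmodType} (phi : G -> R[i]) :=
  forall (I : finType) (g : I -> G) (c : I -> R[i]),
    0 <= \sum_i \sum_j c i * conjc (c j) * phi (g i - g j).

Lemma conjcE {R : realType} (z : R[i]) : conjc z = Num.conj z. Proof. by []. Qed.

Lemma conjcM {R : realType} (z u : R[i]) : conjc (z * u) = conjc z * conjc u.
Proof. exact: rmorphM. Qed.

Lemma conjcN {R : realType} (z : R[i]) : conjc (- z) = - conjc z.
Proof. exact: rmorphN. Qed.

Lemma conjc_norm {R : realType} (z : R[i]) : conjc `|z| = `|z|.
Proof. by rewrite conjcE conj_normC. Qed.

Lemma mulcJ {R : realType} (z : R[i]) : z * conjc z = `|z| ^+ 2.
Proof. by rewrite conjcE normCK. Qed.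

Lemma norm1_conj {R : realType} (z : R[i]) : `|z| = 1 -> z * conjc z = 1.
Proof. by move=> z1; rewrite conjcE -normCK z1 expr1n. Qed.

Section PositiveDefinite.
Context {R : realType} {G : zmodType} (phi : G -> R[i]).
Hypothesis pd : positive_definite phi.

(** The quadratic form at the two points [h] and [0], with coefficients [1] and [u]. *)
Let pd2 (u : R[i]) h :
  0 <= phi 0 + conjc u * phi h + u * phi (- h) + u * conjc u * phi 0.
Proof.
have pd2' (a : R[i]) : 0 <= a * conjc a * phi 0 + a * conjc u * phi h +
    u * conjc a * phi (- h) + u * conjc u * phi 0.
  have := pd (fun b : bool => if b then h else 0) (fun b => if b then a else u).
  by rewrite big_bool /= !big_bool /= !subrr subr0 sub0r !addrA.
by have := pd2' 1; rewrite conjc1 !mul1r mulr1.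
Qed.

Lemma pd0_ge0 : 0 <= phi 0.
Proof. by have := pd2 0 0; rewrite !mul0r !addr0 conjc0 mul0r addr0. Qed.

(** The form [pd2] is real at [u = 1] and at [u = 'i]; these two conditions give the imaginary and
    the real part of the identity. *)
Lemma pdN h : phi (- h) = conjc (phi h).
Proof.
have /ger0_Im := pd2 1 h; have /ger0_Im := pd2 'i%C h.
have /ger0_Im := pd0_ge0.
case: (phi 0) (phi h) (phi (- h)) => a b [c e] [a' b'] /= ->.
move=> h1 h2; apply: complex_ext => /=; lra.
Qed.

(** In [pd2], take for [u] the opposite of the phase of [phi h]: both mixed terms become the
    opposite of the norm of [phi h], and twice the wanted difference is nonnegative. *)
Lemma pd_norm h : `|phi h| <= phi 0.
Proof.
have [->|nz] := eqVneq (phi h) 0; first by rewrite normr0 pd0_ge0.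
have N0 : `|phi h| != 0 by rewrite normr_eq0.
pose u := - phi h / `|phi h|.
have cu : conjc u * phi h = - `|phi h|.
  rewrite /u conjcM conjcN conjc_inv conjc_norm mulrAC !mulNr.
  by rewrite [conjc _ * _]mulrC mulcJ expr2 mulfK.
have uu : u * conjc u = 1.
  apply: norm1_conj; rewrite /u normrM normrN normfV normr_id divff//.
have cu' : u * phi (- h) = - `|phi h|.
  by rewrite pdN -[u]conjcK -conjcM cu conjcN conjc_norm.
have := pd2 u h; rewrite cu cu' uu mul1r.
have -> : phi 0 - `|phi h| - `|phi h| + phi 0 = (phi 0 - `|phi h|) *+ 2 by ring.
by rewrite pmulrn_lge0// subr_ge0.
Qed.

End PositiveDefinite.

(** * Finite approximants of the measure and their limit *)

Definition omega : Type := {n : nat & {ffun 'I_n -> 'I_n.+1}}.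
HB.instance Definition _ := Choice.on omega.
HB.instance Definition _ := isPointed.Build omega (existT _ 0%N [ffun=> ord0]).

Section Approximants.
Context {R : realType} {G : zmodType} (phi : G -> R[i]).
Hypotheses (pd : positive_definite phi) (phi0 : phi 0 = 1).
Variables (c : G -> nat) (gamma : nat -> G) (rt : nat -> R[i]).
Hypotheses (cK : cancel c gamma) (prim_rt : forall n, n.+1.-primitive_root (rt n)).
Local Notation A n := {ffun 'I_n -> 'I_n.+1}.

Definition lift_kernel n (k l : A n) : R[i] :=
  phi (lift_sum gamma k - lift_sum gamma l).

Definition lift_weight n (j : A n) : R[i] := weight (rt n) (@lift_kernel n) j.

(** Up to a positive factor, the weight is the quadratic form of [phi] at the lifted points, with
    conjugate character values as coefficients. *)
Lemma lift_weight_ge0 n (j : A n) : 0 <= lift_weight j.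
Proof.
apply: mulr_ge0; first by rewrite invr_ge0 exprn_ge0// ler0n.
have := pd (@lift_sum _ gamma n n) (fun k => conjc (fchar (rt n) j k)).
rewrite (eq_bigr (fun k =>
  \sum_l (fchar (rt n) j k)^* * fchar (rt n) j l * lift_kernel k l))//.
by move=> k _; apply: eq_bigr => l _; rewrite conjcK.
Qed.

(** By [weight_sum] the left sum is an average of values of [phi] at differences of lifts. Such a
    difference is [g] outside the defect set, and on that set the error is at most 2 because [phi]
    is bounded by [phi 0 = 1]. *)
Lemma lift_weight_approx n (x : A n) g :
  `|\sum_j lift_weight j * fchar (rt n) j x - phi g| <=
  2 * (defect (@lift_sum _ gamma n n) x g)%:R / #|A n|%:R.
Proof.
have A0 : #|A n|%:R != 0 :> R[i].
  by rewrite pnatr_eq0 -lt0n; apply/card_gt0P; exists 0.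
rewrite weight_sum// -[phi g](mulKf A0) -mulrBr normrM normfV normr_nat.
rewrite mulrC ler_wpM2r ?invr_ge0 ?ler0n//.
have -> : #|A n|%:R * phi g = \sum_(l : A n) phi g.
  by rewrite sumr_const mulr_natl.
rewrite -sumrB (le_trans (ler_norm_sum _ _ _))//.
rewrite /defect -sum1_card natr_sum mulr_sumr [leRHS]big_mkcond /=.
apply: ler_sum => l _; rewrite inE /lift_kernel; case: eqP => [->|_] /=.
  by rewrite addrAC subrr add0r subrr normr0.
rewrite mulr1 (le_trans (ler_normB _ _))// -[2]/(1 + 1) -phi0.
by rewrite lerD// pd_norm.
Qed.

(** The approximation at [x = 0], [g = 0] has no defect and is exact. *)
Lemma lift_weight_sum1 n : \sum_(j : A n) lift_weight j = 1.
Proof.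
have := lift_weight_approx (0 : A n) 0.
have -> : defect (@lift_sum _ gamma n n) 0 0 = 0%N.
  by apply/eqP; rewrite cards_eq0; apply/eqP/setP => l; rewrite !inE !addr0 eqxx.
rewrite mulr0 mul0r normr_le0 subr_eq0 phi0 => /eqP <-.
by apply: eq_bigr => j _; rewrite fchar0 mulr1.
Qed.

(** The [n]-th approximant lives on the fibre of [omega] over [n]. Gathering all fibres in one set
    lets every approximant act on the same functions, so that a limit in [n] makes sense. *)
Definition expect n (u : omega -> R) : R :=
  \sum_(j : A n) Re (lift_weight j) * u (existT _ n j).

Lemma lift_weight_Re n (j : A n) : lift_weight j = (Re (lift_weight j))%:C%C.
Proof. by rewrite RRe_real// ger0_real// lift_weight_ge0. Qed.

Lemma Re_lift_weight_sum n : \sum_(j : A n) Re (lift_weight j) = 1.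
Proof.
apply/complexI; rewrite rmorph_sum -[RHS](lift_weight_sum1 n).
by apply: eq_bigr => j _; rewrite [RHS]lift_weight_Re.
Qed.

Lemma Re_lift_weight_ge0 n (j : A n) : 0 <= Re (lift_weight j).
Proof. by rewrite -lecR -lift_weight_Re lift_weight_ge0. Qed.

Lemma expect_norm n u M : (forall o, `|u o| <= M) -> `|expect n u| <= M.
Proof.
move=> uM; rewrite (le_trans (ler_norm_sum _ _ _))//.
rewrite -[leRHS]mul1r -(Re_lift_weight_sum n) mulr_suml.
apply: ler_sum => j _; have w0 := Re_lift_weight_ge0 j.
by rewrite normrM ger0_norm// ler_wpM2l.
Qed.

Lemma bfun_expect u : bfun u -> bfun (expect^~ u).
Proof. by move=> [M uM]; exists M => n; exact: expect_norm. Qed.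

Variable p : ultra nat.
Hypothesis p_oo : eventually `<=` ultra_set p.

Definition lim_expect (u : omega -> R) := ulim p (expect^~ u).

Let lim_expectD u v : bfun u -> bfun v ->
  lim_expect (fun o => u o + v o) = lim_expect u + lim_expect v.
Proof.
move=> bu bv; rewrite /lim_expect -ulimD; [|exact: bfun_expect..].
congr ulim; apply/funext => n; rewrite /expect -big_split.
by apply: eq_bigr => j _; rewrite mulrDr.
Qed.

Let lim_expectZ a u : bfun u ->
  lim_expect (fun o => a * u o) = a * lim_expect u.
Proof.
move=> bu; rewrite /lim_expect -ulimZ; last exact: bfun_expect.
congr ulim; apply/funext => n; rewrite /expect mulr_sumr.
by apply: eq_bigr => j _; rewrite mulrCA.
Qed.

Let le_lim_expect u v : bfun u -> bfun v -> (forall o, u o <= v o) ->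
  lim_expect u <= lim_expect v.
Proof.
move=> bu bv uv; apply: ulim_le; [exact: bfun_expect..|move=> n].
by apply: ler_sum => j _; rewrite ler_wpM2l// Re_lift_weight_ge0.
Qed.

Let lim_expect_cst a : lim_expect (fun=> a) = a.
Proof.
rewrite /lim_expect (_ : (fun n => _) = fun=> a) ?ulim_cst//.
by apply/funext => n; rewrite /expect -mulr_suml Re_lift_weight_sum mul1r.
Qed.

Definition expect_mean : mean R omega :=
  Mean lim_expectD lim_expectZ le_lim_expect lim_expect_cst.

(** The value of the random finite character at the basis vector lifting to [g]. This vector exists
    once [c g < n]; the default 1 keeps the phase unimodular below that and does not affect the
    limit. *)
Definition phase (g : G) (o : omega) : R[i] :=
  let: existT n j := o in
  if insub (c g) is Some i then fchar (rt n) j (basis n i) else 1.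

Lemma phase_norm g o : `|phase g o| = 1.
Proof.
by case: o => n j /=; case: insub => [i|]; rewrite ?normr1 ?fchar_norm.
Qed.

Lemma phaseE n (j : A n) g (i : 'I_n) : c g = i ->
  phase g (existT _ n j) = fchar (rt n) j (basis n i).
Proof. by move=> cg; rewrite /phase cg valK. Qed.

(** The weights are real, so the bound passes to real and imaginary parts separately; [p] refines
    the filter at infinity, so it sees the ordinary limit. *)
Let lim_expect_cvg (Z : omega -> R[i]) (l : R[i]) (K : R) (N : nat) :
  (forall n, (N < n)%N ->
    `|\sum_(j : A n) lift_weight j * Z (existT _ n j) - l| <= (K / n.+1%:R)%:C%C) ->
  lim_expect (fun o => Re (Z o)) = Re l /\ lim_expect (fun o => Im (Z o)) = Im l.
Proof.
move=> Zl.
have KoO : K / n.+1%:R @[n --> \oo] --> (0 : R).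
  rewrite -(mulr0 K); apply: cvgM; first exact: cvg_cst.
  exact: (cvg_harmonic).
have limp (v : nat -> R) r :
    (forall n, (N < n)%N -> `|v n - r| <= K / n.+1%:R) -> ulim p v = r.
  move=> vr; apply: ulim_eq; apply: (@cvg_trans _ (v @ \oo)).
    by move=> S vS; exact: p_oo.
  apply/cvgrPdist_le => e e0; near=> n.
  have Nn : (N < n)%N by near: n; exact: nbhs_infty_gt.
  rewrite distrC (le_trans (vr n Nn))// (le_trans (ler_norm _))//.
  rewrite -normrN -sub0r; near: n.
  exact: ((@cvgrPdist_le _ _ _ _ eventually_filter _ _).1 KoO e e0).
have leC z r : `|z| <= r%:C%C -> `|Re z| <= r /\ `|Im z| <= r :> R.
  rewrite lecR => zr; split; apply: le_trans zr; [exact: normc_Re|exact: normc_Im].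
split; apply: limp => n /Zl /leC [h1 h2].
  apply: le_trans h1; rewrite ReB (big_morph _ (@ReD R) (erefl _)).
  rewrite (eq_bigr (fun j : A n => Re (lift_weight j) * Re (Z (existT _ n j))))// => j _.
  by rewrite [in LHS]lift_weight_Re ReM /= mul0r subr0.
apply: le_trans h2; rewrite ImB (big_morph _ (@ImD R) (erefl _)).
rewrite (eq_bigr (fun j : A n => Re (lift_weight j) * Im (Z (existT _ n j))))// => j _.
by rewrite [in LHS]lift_weight_Re ImM /= mul0r addr0.
Unshelve. all: by end_near. Qed.

Let lift_weight_bound n (x : A n) g k :
  (defect (@lift_sum _ gamma n n) x g * n.+1 <= k * #|A n|)%N ->
  `|\sum_j lift_weight j * fchar (rt n) j x - phi g| <= ((2 * k%:R) / n.+1%:R)%:C%C.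
Proof.
move=> dk; apply: le_trans (lift_weight_approx x g) _.
have A0 : 0 < #|A n|%:R :> R[i].
  by rewrite ltr0n; apply/card_gt0P; exists 0.
rewrite !rmorphM /= fmorphV /= !rmorph_nat -!mulrA ler_wpM2l// ler_pdivrMr//.
by rewrite mulrAC ler_pdivlMr ?ltr0n// -!natrM ler_nat.
Qed.

Lemma lim_expect_phase g :
  lim_expect (fun o => Re (phase g o)) = Re (phi g) /\
  lim_expect (fun o => Im (phase g o)) = Im (phi g).
Proof.
apply: (lim_expect_cvg (K := 2 * 1%:R) (N := c g)) => n gn.
rewrite (eq_bigr (fun j => lift_weight j * fchar (rt n) j (basis n (Ordinal gn)))).
  apply: lift_weight_bound; rewrite mul1n.
  have := @defect_basis _ gamma n n (Ordinal gn); rewrite /= cK; apply.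
  exact: leq_ltn_trans gn.
by move=> j _; rewrite (phaseE j (i := Ordinal gn)).
Qed.

(** The product of phases is one character evaluated at a combination of three basis vectors. That
    vector need not vanish, but its defect against [g + h - (g + h) = 0] is at most the sum of three
    basis defects, whence the constant 3 and the limit [phi 0]. *)
Lemma lim_expect_phaseD g h :
  lim_expect (fun o => Re (phase g o * phase h o * conjc (phase (g + h) o))) = 1.
Proof.
have -> : 1 = Re (phi (g + h - (g + h))) by rewrite subrr phi0.
have [] := @lim_expect_cvg
  (fun o => phase g o * phase h o * conjc (phase (g + h) o)) (phi (g + h - (g + h)))
  (2 * 3%:R) (maxn (maxn (c g) (c h)) (c (g + h))) => // n.
rewrite !gtn_max => /andP[/andP[gn hn] ghn].
have n0 : (0 < n)%N by exact: leq_ltn_trans gn.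
pose b f (fn : (c f < n)%N) := basis n (Ordinal fn).
rewrite (eq_bigr (fun j => lift_weight j * fchar (rt n) j (b g gn + b h hn - b _ ghn))).
  apply: lift_weight_bound.
  have db f (fn : (c f < n)%N) :
      (defect (@lift_sum _ gamma n n) (b f fn) f * n.+1 <= #|A n|)%N.
    by have := @defect_basis _ gamma n n (Ordinal fn); rewrite /= cK; apply.
  set D := defect (@lift_sum _ gamma n n) in db *.
  have DD : (D (b g gn + b h hn - b _ ghn)%R (g + h - (g + h))%R <=
      D (b g gn) g + D (b h hn) h + D (b _ ghn) (g + h)%R)%N.
    exact: leq_trans (defectD _ _ _ _ _) (leq_add (defectD _ _ _ _ _) (defectN _ _ _)).
  apply: leq_trans (leq_mul DD (leqnn n.+1)) _.
  rewrite !mulnDl !mulSn mul0n addn0 addnA.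
  by rewrite !leq_add.
move=> j _; rewrite (phaseE j (i := Ordinal gn))// (phaseE j (i := Ordinal hn))//.
rewrite (phaseE j (i := Ordinal ghn))// conjcE (fchar_conj (prim_rt n)).
by rewrite !(fcharD (prim_rt n)).
Qed.

End Approximants.

(** * Complex limits along an ultrafilter *)

Section ComplexUltraLimit.
Context {R : realType} {T : Type} (p : ultra T).
Implicit Types (z w : T -> R[i]).

Definition culim z : R[i] :=
  Complex (ulim p (fun x => Re (z x))) (ulim p (fun x => Im (z x))).

Definition cbfun z := bfun (fun x => Re (z x)) /\ bfun (fun x => Im (z x)).

Lemma culimM z w : cbfun z -> cbfun w -> culim (fun x => z x * w x) = culim z * culim w.
Proof.
move=> [zR zI] [wR wI].
have bN (u : T -> R) : bfun u -> bfun (fun x => - u x).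
  by move=> [M uM]; exists M => x; rewrite normrN.
apply: complex_ext; rewrite ?ReM ?ImM /= -!ulimM// -?ulimB -?ulimD//; try exact: bfunM.
  by congr ulim; apply/funext => x; rewrite ReM.
by congr ulim; apply/funext => x; rewrite ImM.
Qed.

Lemma culim_conj z : cbfun z -> culim (fun x => conjc (z x)) = conjc (culim z).
Proof.
move=> [zR zI]; apply: complex_ext => /=.
  by congr ulim; apply/funext => x; case: (z x).
rewrite -[RHS]mulN1r -ulimZ//; congr ulim; apply/funext => x.
by rewrite mulN1r; case: (z x).
Qed.

Lemma cbfun_norm1 z : (forall x, `|z x| = 1) -> cbfun z.
Proof.
by move=> z1; split; exists 1 => x;
  rewrite -(norm1_normc (z1 x)) ?normc_Re ?normc_Im.
Qed.

Lemma culim_norm1 z : (forall x, `|z x| = 1) -> `|culim z| = 1.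
Proof.
move=> z1; have bz := cbfun_norm1 z1.
have : culim z * conjc (culim z) = 1.
  rewrite -culim_conj// -culimM//; last first.
    by apply: cbfun_norm1 => x; rewrite conjcE norm_conjC.
  rewrite /culim; under [X in Complex (ulim _ X)]eq_fun do rewrite norm1_conj//.
  under [X in Complex _ (ulim _ X)]eq_fun do rewrite norm1_conj//.
  by rewrite !ulim_cst.
by rewrite mulcJ => /eqP; rewrite sqrp_eq1// => /eqP.
Qed.

End ComplexUltraLimit.

(** * Random characters from almost surely multiplicative functions *)

Section RandomCharacter.
Context {R : realType} {G : zmodType}.
Variables (gamma : nat -> G) (gamma_surj : forall g, exists n, gamma n = g).
Context {d : measure_display} {X : measurableType d} (mu : probability X R).
Variable Z : G -> X -> R[i].
Hypotheses (Z1 : forall g x, `|Z g x| = 1)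
  (mZ : forall g, cbmeasurable (Z g))
  (ZD : forall g h, \int[mu]_x Re (Z g x * Z h x * conjc (Z (g + h) x)) = 1).

Let Y g h x := Re (Z g x * Z h x * conjc (Z (g + h) x)).

Let bY g h : bmeasurable (Y g h).
Proof.
have [] // : cbmeasurable (fun x => Z g x * Z h x * conjc (Z (g + h) x)).
by do !apply: cbmeasurableM => //; exact: cbmeasurable_conj.
Qed.

Let bad g h := [set x | 1 - Y g h x != 0].

Let Yn g h x : `|Z g x * Z h x * conjc (Z (g + h) x)| = 1.
Proof. by rewrite !normrM conjcE norm_conjC !Z1 !mul1r. Qed.

Let mbad g h : measurable (bad g h).
Proof.
have [mY _] := bmeasurableB (bmeasurable_cst 1) (bY g h).
rewrite (_ : bad g h = (fun x => 1 - Y g h x) @^-1` (~` [set 0])).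
  by rewrite -[X in measurable X]setTI; apply: mY => //; exact: measurableC.
by apply/seteqP; split=> x /= /eqP.
Qed.

(* [Y g h <= 1] has integral [1]. *)
Let bad0 g h : mu (bad g h) = 0%E.
Proof.
apply: Rintegral0_null.
- by apply: bmeasurableB => //; exact: bmeasurable_cst.
- by move=> x; rewrite subr_ge0 norm1_Re_le1.
- by rewrite bRintegralB//; [rewrite bRintegral_cst ZD subrr|exact: bmeasurable_cst].
Qed.

(** The union runs over pairs of indices of the enumeration, which makes it a countable union of
    null sets. *)
Let good := ~` \bigcup_(nm : nat * nat) bad (gamma nm.1) (gamma nm.2).

Let mgood : measurable good.
Proof.
by apply: measurableC; apply: countable_bigcupT_measurable.
Qed.

Let good0 : mu (~` good) = 0%E.
Proof.
rewrite setCK; apply/eqP; rewrite -measure_le0.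
pose F k := if unpickle k is Some nm then bad (gamma nm.1) (gamma nm.2) else set0.
have mF k : measurable (F k) by rewrite /F; case: unpickle.
have -> : \bigcup_(nm : nat * nat) bad (gamma nm.1) (gamma nm.2) = \bigcup_k F k.
  apply/seteqP; split=> [x [nm _ bx]|x [k _]].
    by exists (pickle nm) => //; rewrite /F pickleK.
  by rewrite /F; case: unpickle => // nm; exists nm.
apply: (@le_trans _ _ (\sum_(0 <= k <oo) mu (F k))%E).
  apply: (measure_sigma_subadditive mu) => //.
  exact: bigcup_measurable.
by rewrite eseries0// => k _ _; rewrite /F; case: unpickle => //; rewrite measure0.
Qed.

Let goodD x : good x -> forall g h, Z (g + h) x = Z g x * Z h x.
Proof.
move=> gx g h; have [n gn] := gamma_surj g; have [m hm] := gamma_surj h.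
have : ~ bad g h x by move=> b; apply: gx; exists (n, m) => //=; rewrite gn hm.
move=> /negP; rewrite negbK subr_eq0 eq_sym => /eqP /(norm1_Re1 (Yn _ _ _)) e.
rewrite -[RHS]mulr1 -(norm1_conj (Z1 (g + h) x)) mulrC -mulrA -mulrC.
by rewrite [conjc _ * _]mulrC e mul1r.
Qed.

(** The trivial character is substituted on the null set where multiplicativity may fail, so that
    every point yields a genuine character. *)
Let random_character x : dual R G :=
  match pselect (good x) with
  | left gx => Character (goodD gx) (fun g => Z1 g x)
  | right _ => dual1
  end.

Let random_characterE x g : random_character x g = if x \in good then Z g x else 1.
Proof.
rewrite /random_character; case: pselect => gx; first by rewrite mem_set.
by rewrite memNset.
Qed.

Let brandom g : cbmeasurable (fun x => random_character x g).
Proof.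
have [[mR _] [mI _]] := mZ g.
have n1 x : Normc.normc (random_character x g) = 1.
  exact/norm1_normc/char_norm.
split; split.
- under eq_fun do rewrite random_characterE (fun_if (@complex.Re R)).
  exact: measurable_fun_if_mem.
- by exists 1 => x; rewrite -(n1 x) normc_Re.
- under eq_fun do rewrite random_characterE (fun_if (@complex.Im R)).
  exact: measurable_fun_if_mem.
- by exists 1 => x; rewrite -(n1 x) normc_Im.
Qed.

Lemma random_character_law : exists nu : probability (borel_dual R G) R,
  forall g, fourier_coef nu g = cintegral mu (Z g).
Proof.
have mrc : measurable_fun setT (random_character : X -> borel_dual R G).
  apply: (measurable_fun_dual gamma_surj) => g; have [[mR _] [mI _]] := brandom g.
    exact: mR.
  exact: mI.
have [nu [_ nuE]] := pushforward_probability mu mrc.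
have n1 (chi : dual R G) g : Normc.normc (chi g) = 1.
  exact/norm1_normc/char_norm.
exists nu => g; transitivity (cintegral mu (fun x => random_character x g)).
  apply: complex_ext; rewrite /= nuE//; split.
  - exact: measurable_ev_Re.
  - by exists 1 => chi; rewrite -(n1 chi g) normc_Re.
  - exact: measurable_ev_Im.
  - by exists 1 => chi; rewrite -(n1 chi g) normc_Im.
apply: (cintegral_ae mgood good0); [exact: cbmeasurable_borelC..|move=> x gx].
by rewrite random_characterE mem_set.
Qed.

End RandomCharacter.

Lemma countable_cancel {T : pointedType} : countable [set: T] ->
  exists (c : T -> nat) (gamma : nat -> T), cancel c gamma.
Proof.
move=> /countable_injP[c cinj].
have /choice[gamma gammaP] n : exists g, forall h, c h = n -> g = h.
  have [[h hn]|nh] := pselect (exists h, c h = n).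
    by exists h => h' h'n; apply: cinj; rewrite ?inE// hn h'n.
  by exists point => h hn; exfalso; apply: nh; exists h.
by exists c, gamma => g; exact: gammaP.
Qed.

(** The limit mean is represented by a measure on ultrafilters of [omega], and the extended phases
    form the family [Z]. [lim_expect_phaseD] makes [Z] almost surely multiplicative, and
    [lim_expect_phase] computes the coefficients of its law. *)
Theorem bochner {R : realType} {G : zmodType} (phi : G -> R[i]) :
  countable [set: G] -> positive_definite phi -> phi 0 = 1 ->
  exists nu : probability (borel_dual R G) R, forall g, fourier_coef nu g = phi g.
Proof.
move=> /countable_cancel[c [gamma cK]] pd phi0.
have /choice[rt rtP] n := @closed_prim_root_exists R[i] n.+1 isT.
have [p [pU p_oo]] := @ultraFilterLemma nat eventually _.
pose L := expect_mean pd phi0 gamma rtP (Ultra pU).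
pose Z g (q : ultraM omega) : R[i] := culim q (phase c rt g).
have Z1 g q : `|Z g q| = 1 by apply: culim_norm1 => o; exact: phase_norm.
have bz g : cbfun (phase c rt g) by apply: cbfun_norm1 => o; exact: phase_norm.
have mZ g : cbmeasurable (Z g).
  by have [? ?] := bz g; split; exact: bmeasurable_ulim.
have phase_conj g o : `|conjc (phase c rt g o)| = 1.
  by rewrite conjcE norm_conjC phase_norm.
have [||nu nuE] := @random_character_law R G gamma _ _ _ (mean_prob L) Z Z1 mZ.
- by move=> g; exists (c g).
- move=> g h; rewrite -(lim_expect_phaseD pd phi0 cK rtP (p := Ultra pU) p_oo g h).
  rewrite -[RHS](@mean_representation _ _ L).
    apply: eq_Rintegral => q _; rewrite /Z -culim_conj// -!culimM//;
      by apply: cbfun_norm1 => o; rewrite ?normrM ?phase_conj ?phase_norm ?mul1r.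
  have [] // : cbfun (fun o =>
      phase c rt g o * phase c rt h o * conjc (phase c rt (g + h) o)).
  by apply: cbfun_norm1 => o; rewrite !normrM phase_conj !phase_norm ?mulr1.
exists nu => g; rewrite nuE.
have [eR eI] := lim_expect_phase pd phi0 cK rtP (p := Ultra pU) p_oo g.
have [bR bI] := bz g.
by apply: complex_ext; rewrite /= -?eR -?eI; exact: (@mean_representation _ _ L).
Qed.

(** * Correlation measures *)

Section Mixture.
Context {d : measure_display} {X : measurableType d} {R : realType}.
Variables (P Q : probability X R) (t : {nonneg R}) (s : {nonneg R}).
Hypothesis ts : t%:num + s%:num = 1.

Definition mixture : set X -> \bar R := measure_add (mscale t P) (mscale s Q).

HB.instance Definition _ := Measure.on mixture.

Lemma mixtureE A : mixture A = (t%:num%:E * P A + s%:num%:E * Q A)%E.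
Proof. by rewrite /mixture measure_addE. Qed.

Let mixtureT : mixture setT = 1%E.
Proof.
rewrite mixtureE [X in (_ * X + _)%E](probability_setT P).
by rewrite [X in (_ + _ * X)%E](probability_setT Q) !mule1 -EFinD ts.
Qed.

HB.instance Definition _ := Measure_isProbability.Build _ _ _ mixture mixtureT.

Let ge0_Rintegral_mixture (u : X -> R) : bmeasurable u -> (forall x, 0 <= u x) ->
  \int[mixture]_x u x = t%:num * \int[P]_x u x + s%:num * \int[Q]_x u x.
Proof.
move=> bu u0; have mu : measurable_fun setT (EFin \o u).
  by have [mu _] := bu; exact/measurable_EFinP.
have u0' x : [set: X] x -> (0 <= (u x)%:E)%E by rewrite lee_fin.
have Pu := integrable_fin_num measurableT (bmeasurable_integrable P bu).
have Qu := integrable_fin_num measurableT (bmeasurable_integrable Q bu).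
rewrite /Rintegral /mixture ge0_integral_measure_add// !ge0_integral_mscale//.
by rewrite fineD ?fineM// fin_numM.
Qed.

(** Adding the bound [M] reduces to nonnegative functions; both sides increase by [M] because the
    weights sum to 1. *)
Lemma Rintegral_mixture (u : X -> R) : bmeasurable u ->
  \int[mixture]_x u x = t%:num * \int[P]_x u x + s%:num * \int[Q]_x u x.
Proof.
move=> bu; have [_ [M uM]] := bu.
have bM : bmeasurable (fun _ : X => M) by exact: bmeasurable_cst.
have u0 x : 0 <= u x + M by have := uM x; rewrite ler_norml => /andP[]; lra.
have := ge0_Rintegral_mixture (bmeasurableD bu bM) u0.
rewrite (bRintegralD mixture bu bM) (bRintegralD P bu bM) (bRintegralD Q bu bM).
rewrite (bRintegral_cst mixture) (bRintegral_cst P) (bRintegral_cst Q) => h.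
have hM : M = t%:num * M + s%:num * M by rewrite -mulrDl ts mul1r.
by apply: (addIr M); rewrite h [X in _ = _ + X]hM !mulrDr addrACA.
Qed.

Lemma mixture_probability : exists nu : probability X R,
  (forall A, nu A = (t%:num%:E * P A + s%:num%:E * Q A)%E) /\
  forall u : X -> R, bmeasurable u ->
    \int[nu]_x u x = t%:num * \int[P]_x u x + s%:num * \int[Q]_x u x.
Proof. by exists mixture; split; [exact: mixtureE|exact: Rintegral_mixture]. Qed.

End Mixture.

Lemma cintegral_pushforward {d d'} {X : measurableType d} {Y : measurableType d'}
    {R : realType} (mu : probability X R) (nu : probability Y R) (S : X -> Y)
    (F : Y -> R[i]) :
  measurable_fun setT S -> (forall A, measurable A -> mu (S @^-1` A) = nu A) ->
  cbmeasurable F -> cintegral mu (fun x => F (S x)) = cintegral nu F.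
Proof.
move=> mS SE [bR bI]; have [nu' [nuE nuI]] := pushforward_probability mu mS.
have inv (u : Y -> R) : bmeasurable u -> \int[mu]_x u (S x) = \int[nu]_x u x.
  move=> bu; rewrite -nuI// /Rintegral; congr fine.
  by apply: eq_measure_integral => A mA _; exact: etrans (nuE A) (SE A mA).
by apply: complex_ext => /=; [exact: (inv _ bR)|exact: (inv _ bI)].
Qed.

Section Correlation.
Context {R : realType} {G : zmodType} {d : measure_display} {X : measurableType d}.
Variables (mu : probability X R) (T : G -> X -> X).
Hypothesis act : mp_action mu T.

Lemma mp_measurable g : measurable_fun setT (T g).
Proof. by have [_ _ /(_ g)[]] := act. Qed.

Lemma cbmeasurable_act (F : X -> R[i]) g : cbmeasurable F -> cbmeasurable (fun x => F (T g x)).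
Proof.
move=> [[mR [M RM]] [mI [N IN]]]; split; split.
- exact: (measurableT_comp mR (mp_measurable g)).
- by exists M => x.
- exact: (measurableT_comp mI (mp_measurable g)).
- by exists N => x.
Qed.

Lemma cintegral_act (F : X -> R[i]) g : cbmeasurable F ->
  cintegral mu (fun x => F (T g x)) = cintegral mu F.
Proof. by move=> bF; have [_ _ /(_ g)[mT TE]] := act; exact: cintegral_pushforward. Qed.

Variable F : X -> R[i].
Hypothesis bF : cbmeasurable F.

Definition correlation (h : G) : R[i] :=
  cintegral mu (fun x => F (T h x) * conjc (F x)).

(** Invariance under [T h] moves the shift by [- h] to the conjugated factor. *)
Lemma correlationB g h :
  correlation (g - h) = cintegral mu (fun x => F (T g x) * conjc (F (T h x))).
Proof.
rewrite /correlation -[LHS](cintegral_act h) => [|].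
  have [_ TD _] := act; congr cintegral; apply/funext => x.
  by rewrite -[T _ (T h x)]/((T (g - h) \o T h) x) -TD subrK.
by apply: cbmeasurableM; [exact: cbmeasurable_act|exact: cbmeasurable_conj].
Qed.

(** The quadratic form is the integral of the squared modulus of [S], the combination of the
    translates of [F] with coefficients [c]. *)
Lemma correlation_pd : positive_definite correlation.
Proof.
move=> I g c.
pose S x := \sum_i c i * F (T (g i) x).
have bT i : cbmeasurable (fun x => F (T (g i) x)) by exact: cbmeasurable_act.
have bc i : cbmeasurable (fun x => c i * F (T (g i) x)).
  by apply: cbmeasurableM => //; exact: cbmeasurable_cst.
have bb i j : cbmeasurable (fun x => c i * F (T (g i) x) * conjc (c j * F (T (g j) x))).
  by apply: cbmeasurableM => //; exact: cbmeasurable_conj.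
suff -> : \sum_i \sum_j c i * conjc (c j) * correlation (g i - g j) =
    cintegral mu (fun x => S x * conjc (S x)).
  by apply: cintegral_ge0 => x; rewrite mulcJ exprn_ge0.
transitivity (cintegral mu (fun x =>
    \sum_i \sum_j c i * F (T (g i) x) * conjc (c j * F (T (g j) x)))).
  rewrite cintegral_sum => [|i]; last exact: cbmeasurable_sum.
  apply: eq_bigr => i _; rewrite cintegral_sum//; apply: eq_bigr => j _.
  rewrite correlationB -cintegralZ; last first.
    by apply: cbmeasurableM => //; exact: cbmeasurable_conj.
  by congr cintegral; apply/funext => x; rewrite conjcM; ring.
congr cintegral; apply/funext => x; rewrite /S raddf_sum /= mulr_suml.
by apply: eq_bigr => i _; rewrite mulr_sumr.
Qed.

End Correlation.

Section EssentiallyBounded.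
Context {d : measure_display} {X : measurableType d} {R : realType}.
Variable mu : probability X R.

(** Truncating to 0 where the real or imaginary part exceeds an essential bound changes [f] only on
    a null set. *)
Lemma Linfty_bounded (f : X -> R[i]) : Linfty mu f ->
  exists (f' : X -> R[i]) (E : set X),
    [/\ cbmeasurable f', measurable E, mu (~` E) = 0%E & forall x, E x -> f x = f' x].
Proof.
move=> [mf finf].
have mR := measurableT_comp measurable_Re mf; have mI := measurableT_comp measurable_Im mf.
have [M [N [mN N0 NM]]] : exists M, \forall x \ae mu, `|Normc.normc (f x)| <= M.
  apply: ess_supr_bounded; move: finf; rewrite /finite_norm unlock /Lnorm.
  have mT : (0 < mu setT)%E by rewrite [X in (_ < X)%E](probability_setT mu) lte01.
  by rewrite mT.
pose E := [set x | `|Re (f x)| <= M] `&` [set x | `|Im (f x)| <= M].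
have mE : measurable E.
  have mle (u : X -> R) : measurable_fun setT u -> measurable [set x | `|u x| <= M].
    move=> mu'; rewrite (_ : [set x | _] = u @^-1` `[- M, M]).
      by rewrite -[X in measurable X]setTI; exact: mu'.
    by apply/seteqP; split=> x /=; rewrite in_itv /= ler_norml.
  by apply: measurableI; exact: mle.
have bif (u : X -> R) : measurable_fun setT u -> (forall x, E x -> `|u x| <= M) ->
    bmeasurable (fun x => if x \in E then u x else 0).
  move=> mu' uM; split.
    exact: measurable_fun_if_mem.
  exists `|M| => x; case: ifPn => [|_]; last by rewrite normr0.
  by rewrite inE => /uM /le_trans; apply; exact: ler_norm.
exists (fun x => if x \in E then f x else 0), E; split=> //.
- split; [under eq_fun do rewrite (fun_if (@complex.Re R))|
          under eq_fun do rewrite (fun_if (@complex.Im R))].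
    by apply: bif => // x [].
  by apply: bif => // x [].
- apply: (subset_measure0 _ mN) => //; first exact: measurableC.
  move=> x nEx; apply: NM => /= fM; apply: nEx.
  have {}fM := le_trans (ler_norm _) fM.
  by split; [exact: le_trans (normc_Re _) fM|exact: le_trans (normc_Im _) fM].
- by move=> x Ex; rewrite mem_set.
Qed.

End EssentiallyBounded.

Section CorrelationMeasure.
Context {R : realType} {G : zmodType} (G_countable : countable [set: G]).

(** Division by [phi 0] reduces to [bochner]; if [phi 0 = 0], then [phi] vanishes by [pd_norm] and
    any measure serves. *)
Lemma bochner_scaled (phi : G -> R[i]) : positive_definite phi ->
  exists nu : probability (borel_dual R G) R,
    forall g, phi g = phi 0 * fourier_coef nu g.
Proof.
move=> pd; have [phi0|phi0] := eqVneq (phi 0) 0.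
  exists point => g; have := pd_norm pd g.
  by rewrite phi0 normr_le0 mul0r => /eqP.
have [|nu nuE] := @bochner R G (fun g => (phi 0)^-1 * phi g) G_countable _ (mulVf phi0).
  move=> I g c; rewrite (_ : \sum_i _ = (phi 0)^-1 *
      \sum_i \sum_j c i * conjc (c j) * phi (g i - g j)).
    by rewrite mulr_ge0// ?invr_ge0 ?pd0_ge0.
  rewrite mulr_sumr; apply: eq_bigr => i _; rewrite mulr_sumr.
  by apply: eq_bigr => j _; rewrite mulrCA.
by exists nu => g; rewrite nuE mulVKf.
Qed.

Lemma cbmeasurable_ev (g : G) :
  cbmeasurable ((fun chi => chi g) : borel_dual R G -> R[i]).
Proof.
have n1 (chi : dual R G) : Normc.normc (chi g) = 1.
  exact/norm1_normc/char_norm.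
split; split; [exact: measurable_ev_Re| |exact: measurable_ev_Im| ];
  by exists 1 => chi; rewrite -(n1 chi) ?normc_Re ?normc_Im.
Qed.

Lemma correlation_measure {d} {X : measurableType d} (mu : probability X R)
    (T : G -> X -> X) (f : X -> R[i]) :
  mp_action mu T -> cbmeasurable f -> cintegral mu f != 0 ->
  exists (nu : probability (borel_dual R G) R) (a : R),
    [/\ 0 < a, (a%:E <= nu [set dual1])%E, correlation mu T f 0 != 0 &
    forall h, correlation mu T f h = correlation mu T f 0 * fourier_coef nu h].
Proof.
move=> act bf; set c := cintegral mu f => c0.
(* Centering [f] splits off the constant correlation [|c|^2], which is the
   Fourier transform of [|c|^2 * delta_1]. *)
pose f0 x := f x - c.
have bf0 : cbmeasurable f0 by apply: cbmeasurableD => //; exact: cbmeasurable_cst.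
have cf0 : cintegral mu f0 = 0.
  by rewrite cintegralD ?cintegral_cst ?subrr//; exact: cbmeasurable_cst.
have corE h : correlation mu T f h = c * conjc c + correlation mu T f0 h.
  have bT : cbmeasurable (fun x => f0 (T h x)) by exact: (cbmeasurable_act act).
  have bc := cbmeasurable_conj bf0.
  have b1 := cbmeasurableM bT bc.
  have k z : cbmeasurable (fun _ : X => z : R[i]) by exact: cbmeasurable_cst.
  (* The two mixed terms integrate to zero because [f0] has integral zero and [T h] preserves
     [mu]. *)
  transitivity (cintegral mu (fun x => c * conjc c + (c * conjc (f0 x) +
      (conjc c * f0 (T h x) + f0 (T h x) * conjc (f0 x))))).
    congr cintegral; apply/funext => x; rewrite -[f (T h x)](subrK c) -/(f0 _).
    rewrite -[in LHS](subrK c (f x)) -/(f0 x) [conjc (_ + _)](rmorphD (@conjc R)) /=; ring.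
  rewrite cintegralD ?cintegral_cst//; last first.
    by do !(apply: cbmeasurableD => //); exact: cbmeasurableM.
  congr (_ + _); rewrite cintegralD ?cintegralZ ?cintegral_conj//; last first.
  - by apply: cbmeasurableD => //; exact: cbmeasurableM.
  - exact: cbmeasurableM.
  rewrite cf0 conjc0 mulr0 add0r cintegralD ?cintegralZ//; last exact: cbmeasurableM.
  by rewrite (cintegral_act act)// cf0 mulr0 add0r.
have pd := correlation_pd act bf0.
have [nu0 nu0E] := bochner_scaled pd.
(* The total masses of the atomic part and of the centered part. Dividing by [A + B] turns their sum
   into a probability with mass at least [A / (A + B)] at the trivial character. *)
pose A := Re (c * conjc c); pose B := Re (correlation mu T f0 0).
have AE : c * conjc c = A%:C%C by rewrite RRe_real// ger0_real// mulcJ exprn_ge0.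
have BE : correlation mu T f0 0 = B%:C%C by rewrite RRe_real// ger0_real// pd0_ge0.
have A0 : 0 < A.
  by rewrite -ltcR -AE mulcJ exprn_gt0// normr_gt0.
have B0 : 0 <= B by rewrite -lecR -BE pd0_ge0.
have AB0 : 0 < A + B by rewrite ltr_wpDr.
have t0 : 0 <= A / (A + B) by rewrite divr_ge0// ltW.
have s0 : 0 <= B / (A + B) by rewrite divr_ge0// ltW.
have ts : (NngNum t0)%:num + (NngNum s0)%:num = 1 by rewrite /= -mulrDl divff// gt_eqF.
pose D : probability (borel_dual R G) R := dirac (dual1 : borel_dual R G).
have [nu [nuE nuI]] := mixture_probability D nu0 ts.
have DI (u : borel_dual R G -> R) : measurable_fun setT u -> \int[D]_x u x = u dual1.
  move=> mu'; rewrite /Rintegral integral_dirac//; last exact/measurable_EFinP.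
  by rewrite diracT mul1e.
exists nu, (A / (A + B)); split; first by rewrite divr_gt0.
  rewrite nuE [X in (_ * X + _)%E](_ : _ = 1%E); last by rewrite /D /= diracE mem_set.
  by rewrite mule1 leeDl// mule_ge0// lee_fin.
  by rewrite corE AE BE -rmorphD /= eq_complex /= gt_eqF.
move=> h; rewrite !corE (nu0E h) AE BE.
have [bR bI] := cbmeasurable_ev h.
have -> : fourier_coef nu h =
    (A / (A + B))%:C%C + (B / (A + B))%:C%C * fourier_coef nu0 h.
  apply: complex_ext; rewrite ?ReD ?ImD ?ReM ?ImM /= nuI// DI /=.
  - by rewrite mul0r subr0 mulr1.
  - by case: bR.
  - by rewrite mulr0 !add0r mul0r addr0.
  - by case: bI.
move: (fourier_coef nu0 h) => z.
have nz : (A%:C + B%:C)%C != 0 by rewrite -rmorphD /= eq_complex /= gt_eqF.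
have E r : (r / (A + B))%:C%C = r%:C%C / (A%:C%C + B%:C%C) :> R[i].
  by rewrite rmorphM fmorphV rmorphD.
by rewrite !E; field.
Qed.

Lemma vdC_of_dual (H : set G) :
  (forall mu : probability (borel_dual R G) R,
    (forall h, H h -> fourier_coef mu h = 0) -> mu [set (dual1 : dual R G)] = 0%E) ->
  vdC_set R G H.
Proof.
move=> Hdual d X mu T act f Lf fH.
have [mf _] := Lf; have [f' [E [bf' mE E0 ff']]] := Linfty_bounded Lf.
have mf' := cbmeasurable_borelC bf'.
rewrite (cintegral_ae mE E0 mf mf' ff'); apply/eqP; apply: contraT => c0.
have [nu [a [a0 nua corr0 nuE]]] := correlation_measure act bf' c0.
suff /Hdual nu0 : forall h, H h -> fourier_coef nu h = 0.
  by move: nua; rewrite nu0 lee_fin leNgt a0.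
move=> h Hh; apply: (mulfI corr0); rewrite -nuE mulr0 -[RHS](fH h Hh).
have mT := mp_measurable act h.
have mTE : measurable (T h @^-1` E) by rewrite -[X in measurable X]setTI; exact: mT.
(* The functions [f] and [f'] have to agree at both [x] and [T h x]; the preimage of [E] has full
   measure since [T h] preserves [mu]. *)
apply/esym/(@cintegral_ae _ _ _ mu (E `&` T h @^-1` E)).
- exact: measurableI.
- apply/eqP; rewrite -measure_le0 setCI (le_trans (measureU2 _ _ _))//; try exact: measurableC.
  rewrite [X in (X + _)%E]E0 add0e; have [_ _ /(_ h)[_ inv]] := act.
  have -> : ~` (T h @^-1` E) = T h @^-1` (~` E) by [].
  by rewrite [X in (X <= _)%E](inv _ (measurableC mE)) E0.
- apply: measurable_borelCM; first exact: (measurableT_comp mf mT).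
  exact: measurable_borelC_conj.
- apply: measurable_borelCM; first exact: (measurableT_comp mf' mT).
  exact: measurable_borelC_conj.
- by move=> x [Ex ETx]; rewrite !ff'.
Qed.

End CorrelationMeasure.

(** * The circle extension *)

Section Circle.
Context {R : realType}.

(** The function [exp (2 pi i t)], scaled to have period 1. *)
Definition cexp (t : R) : R[i] := Complex (cos (t * (pi *+ 2))) (sin (t * (pi *+ 2))).

Lemma cexpD s t : cexp (s + t) = cexp s * cexp t.
Proof.
apply: complex_ext; rewrite ?ReM ?ImM /= mulrDl ?cosD ?sinD//.
by rewrite addrC [cos _ * sin _]mulrC mulrC [sin _ * cos _]mulrC addrC mulrC.
Qed.

Lemma cexp1 t : cexp (t + 1) = cexp t.
Proof. by rewrite /cexp mulrDl mul1r cosD2pi sinD2pi. Qed.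

Lemma cexp_norm t : `|cexp t| = 1.
Proof. by rewrite normc_def /= cos2Dsin2 sqrtr1. Qed.

(** The arc cosine of the real part parametrizes the upper half circle; the lower half is reached by
    conjugation, which replaces [t] by [1 - t]. *)
Lemma cexp_surj (u : R[i]) : `|u| = 1 -> exists2 t, 0 <= t <= 1 & cexp t = u.
Proof.
move=> /(congr1 (fun z => z ^+ 2)); rewrite -add_Re2_Im2 expr1n.
case: u => a b /= /complexI ab1.
have a1 : -1 <= a <= 1.
  rewrite -ler_norml -(@ler_pXn2r _ 2)// ?nnegrE// real_normK ?num_real// expr1n -ab1.
  by rewrite lerDl sqr_ge0.
have pi2 : 0 < pi *+ 2 :> R by rewrite mulrn_wgt0// pi_gt0.
have ac : 0 <= acos a <= pi by rewrite acos_ge0// acos_lepi.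
have sb : sin (acos a) = `|b|.
  by rewrite sin_acos// -sqrtr_sqr; congr Num.sqrt; lra.
have t01 : 0 <= acos a / (pi *+ 2) <= 1.
  case/andP : ac => ac0 acpi; rewrite divr_ge0// ?(ltW pi2)//= ler_pdivrMr// mul1r.
  by rewrite (le_trans acpi)// mulr2n lerDl pi_ge0.
have tK : acos a / (pi *+ 2) * (pi *+ 2) = acos a by rewrite mulfVK// gt_eqF.
have [b0|b0] := leP 0 b.
  exists (acos a / (pi *+ 2)) => //; rewrite /cexp tK sb acosK ?in_itv//.
  by rewrite ger0_norm.
exists (1 - acos a / (pi *+ 2)); first by lra.
rewrite -[_ - _]addrC cexp1 /cexp mulNr tK cosN sinN sb acosK ?in_itv//.
by rewrite ltr0_norm// opprK.
Qed.

Lemma measurable_cexp : measurable_fun setT (cexp : measurableTypeR R -> borelC R).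
Proof.
have mm : measurable_fun setT
    ((fun t => t * (pi *+ 2)) : measurableTypeR R -> measurableTypeR R).
  exact: mulrr_measurable.
apply: measurable_fun_borelC.
  apply: (measurableT_comp _ mm); apply: continuous_measurable_fun.
  exact: continuous_cos.
apply: (measurableT_comp _ mm); apply: continuous_measurable_fun.
exact: continuous_sin.
Qed.

Local Notation leb := (@lebesgue_measure R).

(** The image of Lebesgue measure under the translation gives half-open intervals their length, so
    uniqueness of Lebesgue measure applies. *)
Lemma lebesgue_measureD (A : set (measurableTypeR R)) (t : R) : measurable A ->
  leb ((fun x : measurableTypeR R => x + t) @^-1` A) = leb A.
Proof.
move=> mA.
have mD : measurable_fun setT ((fun x => x + t) : measurableTypeR R -> measurableTypeR R).
  by apply: measurable_funD.
pose F : {mfun measurableTypeR R >-> measurableTypeR R} :=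
  HB.pack (fun x : measurableTypeR R => x + t : measurableTypeR R)
    (isMeasurableFun.Build _ _ _ _ _ mD).
apply/esym/(@lebesgue_measure_unique _ (pushforward leb F)) => //= _ [[a b]] _ <-.
rewrite /pushforward (_ : _ @^-1` _ = `](a - t), (b - t)]%classic).
  rewrite !lebesgue_measure_itv /= !lte_fin ltrD2r; case: ifP => // _.
  by rewrite !EFinN -!EFinD; congr EFin; ring.
by apply/seteqP; split=> x /=; rewrite !in_itv /= ltrBlDr lerBrDr.
Qed.

Let m01 : measurable (`[0, 1[%classic : set (measurableTypeR R)).
Proof. exact: measurable_itv. Qed.

Definition unit_leb : set (measurableTypeR R) -> \bar R := mrestr leb m01.

HB.instance Definition _ := Measure.on unit_leb.

Let unit_lebT : unit_leb setT = 1%E.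
Proof.
by rewrite /unit_leb /mrestr setTI lebesgue_measure_itv /= lte_fin ltr01 sube0.
Qed.

HB.instance Definition _ := Measure_isProbability.Build _ _ _ unit_leb unit_lebT.

(** Rotation invariance on the circle [R/Z], whose Borel sets are represented by periodic sets. *)
Lemma unit_leb_shift (B : set (measurableTypeR R)) (t : R) :
  measurable B -> (forall x, B (x + 1) <-> B x) -> 0 <= t <= 1 ->
  unit_leb ((fun x => x + t) @^-1` B) = unit_leb B.
Proof.
move=> mB perB /andP[t0 t1]; rewrite /unit_leb /mrestr.
have mI (a b : R) : measurable (B `&` `[a, b[).
  by apply: measurableI => //; exact: measurable_itv.
(* Both sides are compared on [[0, t[] and [[t, 1[]: the part of [[t, 1 + t[] beyond
   [1] is moved back by periodicity. *)
have split3 (a b c : R) : a <= b -> b <= c ->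
    leb (B `&` `[a, c[) = (leb (B `&` `[a, b[) + leb (B `&` `[b, c[))%E.
  move=> ab bc; rewrite -measureU//.
    rewrite -setIUr; congr (leb (B `&` _)); apply/seteqP; split=> x /=; rewrite !in_itv /=.
      by move=> /andP[-> ->]; rewrite andbT; case: (ltP x b) => _; [left|right].
    case=> /andP[ax xb]; first by rewrite ax (lt_le_trans xb).
    by rewrite xb (le_trans ab).
  apply/seteqP; split=> // x [[_ h1] [_ h2]]; move: h1 h2; rewrite /= !in_itv /=.
  by move=> /andP[_ xb] /andP[/(lt_le_trans xb)]; rewrite ltxx.
have -> : ((fun x => x + t) @^-1` B) `&` `[0, 1[ =
    (fun x => x + t) @^-1` (B `&` `[t, 1 + t[).
  apply/seteqP; split=> x /= [Bx]; rewrite !in_itv /= => /andP[h1 h2]; split=> //;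
    apply/andP; split; lra.
rewrite lebesgue_measureD// (split3 t 1)//; last by rewrite lerDl.
rewrite (split3 0 t 1)// addeC; congr (_ + _)%E.
rewrite -(lebesgue_measureD 1)//; congr leb.
apply/seteqP; split=> x /= [Bx]; rewrite !in_itv /= => /andP[h1 h2];
  (split; [by apply/perB|apply/andP; split; lra]).
Qed.

(** Haar measure of the circle, viewed on the plane. It is the image of Lebesgue measure under
    [cexp], which turns translations into rotations. *)
Lemma circle_measure : exists kappa : probability (borelC R) R,
  kappa (~` [set z | `|z| = 1]) = 0%E /\
  forall (u : R[i]) (A : set (borelC R)), `|u| = 1 -> measurable A ->
    kappa ((fun z => u * z) @^-1` A) = kappa A.
Proof.
have [kappa [kE _]] := pushforward_probability unit_leb measurable_cexp.
exists kappa; split.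
  rewrite kE (_ : _ @^-1` _ = set0) ?measure0//.
  by apply/seteqP; split=> // t /=; rewrite cexp_norm.
move=> u A u1 mA; have [t t01 <-] := cexp_surj u1; rewrite !kE.
have mB : measurable (cexp @^-1` A : set (measurableTypeR R)).
  by rewrite -[X in measurable X]setTI; exact: measurable_cexp.
have perB x : (cexp @^-1` A) (x + 1) <-> (cexp @^-1` A) x by rewrite /= cexp1.
apply: etrans (unit_leb_shift mB perB t01).
by congr unit_leb; apply/seteqP; split=> x /=; rewrite addrC cexpD.
Qed.

End Circle.

Section ProductProbability.
Context {d d' : measure_display} {X : measurableType d} {Y : measurableType d'}.
Context {R : realType} (P : probability X R) (Q : probability Y R).

Definition prod_prob : set (X * Y) -> \bar R := (P \x Q)%E.

HB.instance Definition _ := Measure.on prod_prob.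

Lemma prod_probX A B : measurable A -> measurable B ->
  prod_prob (A `*` B) = (P A * Q B)%E.
Proof. exact: product_measure1E. Qed.

Let prod_probT : prod_prob setT = 1%E.
Proof.
rewrite -setXTT prod_probX// [X in (X * _)%E](probability_setT P).
by rewrite [X in (_ * X)%E](probability_setT Q) mule1.
Qed.

HB.instance Definition _ := Measure_isProbability.Build _ _ _ prod_prob prod_probT.

(** The product measure integrates the [Q]-measures of sections, and the section of the preimage
    over [x] is a preimage under [S x]. *)
Lemma prod_prob_fiber (S : X -> Y -> Y) :
  measurable_fun setT (fun xy : X * Y => (xy.1, S xy.1 xy.2)) ->
  (forall x A, measurable A -> Q (S x @^-1` A) = Q A) ->
  forall A, measurable A ->
    prod_prob ((fun xy => (xy.1, S xy.1 xy.2)) @^-1` A) = prod_prob A.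
Proof.
move=> mS SQ A mA; rewrite /prod_prob /product_measure1 /=.
apply: eq_integral => x _.
rewrite -(SQ x (xsection A x)); last exact: measurable_xsection.
congr (Q _); apply/seteqP; split=> y; rewrite /xsection /= !inE//.
Qed.

End ProductProbability.

(** * The system on the product of the dual and the circle *)

Section DualToSystem.
Context {R : realType} {G : zmodType} (G_countable : countable [set: G]).

Let countable_enum : exists gamma : nat -> G, forall g, exists n, gamma n = g.
Proof.
by have [c [gamma cK]] := countable_cancel G_countable; exists gamma => g; exists (c g).
Qed.

Variables (nu : probability (borel_dual R G) R) (kappa : probability (borelC R) R).
Hypotheses (kappa_circle : kappa (~` [set z | `|z| = 1]) = 0%E)
  (kappa_rot : forall (u : R[i]) (A : set (borelC R)), `|u| = 1 -> measurable A ->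
    kappa ((fun z => u * z) @^-1` A) = kappa A).

Let X : measurableType _ := (borel_dual R G * borelC R)%type.
Let mu : probability X R := prod_prob nu kappa.

Let T (g : G) (x : X) : X := (x.1, (x.1 : dual R G) g * x.2 : R[i]).

Let char0 (chi : dual R G) : chi 0 = 1.
Proof.
have nz : chi 0 != 0 by rewrite -normr_eq0 char_norm oner_eq0.
by apply: (mulfI nz); rewrite -charD addr0 mulr1.
Qed.

Let mchar g : measurable_fun setT ((fun x : X => (x.1 : dual R G) g) : X -> borelC R).
Proof.
apply: measurable_fun_borelC.
  exact: (measurableT_comp (measurable_ev_Re g) measurable_fst).
exact: (measurableT_comp (measurable_ev_Im g) measurable_fst).
Qed.

(** The rotation may depend on the character. This covers both the action, with [S chi = chi g], and
    the sign change, with [S] constantly [-1]. *)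
Let mrot (S : borel_dual R G -> R[i]) :
  measurable_fun setT ((fun x : X => S x.1) : X -> borelC R) ->
  (forall chi, `|S chi| = 1) ->
  measure_preserving mu (fun x : X => (x.1, S x.1 * x.2 : R[i])).
Proof.
move=> mS S1.
have mf : measurable_fun setT (fun x : X => (x.1, S x.1 * x.2 : R[i]) : X).
  apply: measurable_fun_pair; first exact: measurable_fst.
  by apply: measurable_borelCM => //; exact: measurable_snd.
split=> // A mA.
apply: (@prod_prob_fiber _ _ _ _ _ nu kappa (fun chi z => S chi * z) mf _ A mA).
by move=> chi B mB; exact: kappa_rot.
Qed.

Let act : mp_action mu T.
Proof.
split.
- by apply/funext => -[chi z]; rewrite /T /= char0 mul1r.
- by move=> g h; apply/funext => -[chi z]; rewrite /T /= charD mulrA.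
- move=> g.
  exact: (@mrot (fun chi => (chi : dual R G) g) (mchar g) (fun chi => char_norm chi g)).
Qed.

Let circ : set X := [set x | `|x.2 : R[i]| = 1].

Let mnorm1 : measurable ([set z | `|z| = 1] : set (borelC R)).
Proof.
have mR := @measurable_Re R; have mI := @measurable_Im R.
have mq : measurable_fun setT (fun z : borelC R => Re z * Re z + Im z * Im z).
  by apply: measurable_funD; exact: measurable_funM.
rewrite (_ : [set z | _] = (fun z : borelC R => Re z * Re z + Im z * Im z) @^-1` [set 1]).
  by rewrite -[X in measurable X]setTI; exact: mq.
apply/seteqP; split=> z /=.
  move=> /(congr1 (fun z => z ^+ 2)); rewrite -add_Re2_Im2 expr1n => /complexI.
  by rewrite !expr2.
by rewrite -!expr2 normc_def => ->; rewrite sqrtr1.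
Qed.

Let circE : circ = setT `*` [set z | `|z| = 1].
Proof. by apply/seteqP; split=> x //= []. Qed.

Let mcirc : measurable circ.
Proof. by rewrite circE; exact: measurableX. Qed.

Let circ0 : mu (~` circ) = 0%E.
Proof.
rewrite (_ : ~` circ = setT `*` ~` [set z | `|z| = 1]).
  rewrite [LHS]prod_probX//; last exact: measurableC.
  by rewrite kappa_circle mule0.
by apply/seteqP; split=> x /=; [move=> h; split|case].
Qed.

Let one_ : set X := [set dual1] `*` setT.

Let mone : measurable one_.
Proof.
have [gamma gs] := countable_enum.
by apply: measurableX => //; exact: (measurable_dual1 gs).
Qed.

(** The value 0 occurs only off [circ], hence on a null set, and keeps the function bounded on the
    whole plane. *)
Let F (x : X) : R[i] :=
  if x \in one_ then 1 else if x \in circ then x.2 else 0.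

Let F_norm x : Normc.normc (F x) <= 1.
Proof.
rewrite /F; case: ifPn => _; first by rewrite Normc.normc1.
case: ifPn => [|_]; last by rewrite Normc.normc0.
by rewrite inE /circ /= => /(congr1 (@complex.Re R)) /= ->.
Qed.

Let bF : cbmeasurable F.
Proof.
have mR : measurable_fun setT (fun x : X => Re x.2).
  exact: (measurableT_comp measurable_Re measurable_snd).
have mI : measurable_fun setT (fun x : X => Im x.2).
  exact: (measurableT_comp measurable_Im measurable_snd).
split; split; try by exists 1 => x; rewrite (le_trans _ (F_norm x)) ?normc_Re ?normc_Im.
  under eq_fun do rewrite /F (fun_if (@complex.Re R)) (fun_if (@complex.Re R)).
  by apply: measurable_fun_if_mem => //; exact: measurable_fun_if_mem.
under eq_fun do rewrite /F (fun_if (@complex.Im R)) (fun_if (@complex.Im R)).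
by apply: measurable_fun_if_mem => //; exact: measurable_fun_if_mem.
Qed.

Let LinftyF : Linfty mu F.
Proof.
split; first exact: cbmeasurable_borelC.
rewrite /finite_norm unlock; case: ifP => // _.
apply: (@le_lt_trans _ _ 1%:E); last exact: ltry.
apply/ess_supP/aeW => x; rewrite /= lee_fin.
by rewrite ger0_norm// (le_trans _ (normc_Re (F x))).
Qed.

Let one_char (x : X) g : x \in one_ -> (x.1 : dual R G) g = 1.
Proof. by rewrite inE /one_ /= => -[-> _]. Qed.

(** The action fixes the character, so the same case of [F] applies to both factors: both sides are
    1 over the trivial character, and otherwise the circle coordinate cancels against its
    conjugate. *)
Let F_corr h x : circ x -> F (T h x) * conjc (F x) = (x.1 : dual R G) h.
Proof.
move=> cx; rewrite /F.
have -> : (T h x \in one_) = (x \in one_) by apply/idP/idP; rewrite !inE.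
have -> : T h x \in circ.
  by rewrite inE /circ /T /= normrM char_norm mul1r.
case: ifPn => [xone|_]; first by rewrite one_char// conjc1 mul1r.
by rewrite mem_set//= -mulrA norm1_conj// mulr1.
Qed.

Let correlationF h : cintegral mu (fun x => F (T h x) * conjc (F x)) = fourier_coef nu h.
Proof.
rewrite (cintegral_ae mcirc circ0 _ (mchar h)); last exact: F_corr.
  apply: (@cintegral_pushforward _ _ _ _ _ mu nu fst (fun chi : dual R G => chi h)).
  - exact: measurable_fst.
  - move=> A mA; rewrite (_ : _ @^-1` _ = A `*` setT); last first.
      by apply/seteqP; split=> x /=; [move=> ?; split|case].
    by rewrite [LHS]prod_probX// [X in (_ * X)%E](probability_setT kappa) mule1.
  - exact: cbmeasurable_ev.
apply: cbmeasurable_borelC; apply: cbmeasurableM; last exact: cbmeasurable_conj.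
exact: (cbmeasurable_act act).
Qed.

(** Over the trivial character this vanishes; over the others it is odd in the circle coordinate. *)
Let odd_part (x : X) : R[i] := F x - (\1_one_ x)%:C%C.

Let bone : cbmeasurable (fun x : X => (\1_one_ x)%:C%C : R[i]).
Proof.
split; last exact: bmeasurable_cst.
split; first exact: measurable_indic.
by exists 1 => x; rewrite /= indicE; case: (_ \in _); rewrite ?normr1 ?normr0.
Qed.

Let bodd : cbmeasurable odd_part.
Proof.
rewrite (_ : odd_part = fun x => F x + (-1) * (\1_one_ x)%:C%C).
  by apply: cbmeasurableD => //; apply: cbmeasurableM => //; exact: cbmeasurable_cst.
by apply/funext => x; rewrite mulN1r.
Qed.

(* The map [(chi, z) |-> (chi, -z)] preserves [mu] and changes the sign. *)
Let cintegral_odd_part : cintegral mu odd_part = 0.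
Proof.
have [mS SE] : measure_preserving mu (fun x : X => (x.1, -1 * x.2 : R[i])).
  apply: (@mrot (fun=> -1)) => [|chi]; last by rewrite normrN1.
  exact/cbmeasurable_borelC/cbmeasurable_cst.
have : cintegral mu odd_part = - cintegral mu odd_part.
  rewrite -{1}(cintegral_pushforward mS SE bodd) -[RHS]mulN1r -cintegralZ//.
  congr cintegral; apply/funext => x; rewrite /odd_part /F !indicE.
  have -> : ((x.1, -1 * x.2) : X) \in one_ = (x \in one_) by apply/idP/idP; rewrite !inE.
  have -> : ((x.1, -1 * x.2) : X) \in circ = (x \in circ).
    by apply/idP/idP; rewrite !inE /circ /= mulN1r normrN.
  case: ifPn => _ /=; first by rewrite subrr mulr0.
  by case: ifPn => _; rewrite !subr0 ?mulr0.
by move=> /eqP; rewrite -addr_eq0 -mulr2n mulrn_eq0 => /eqP.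
Qed.

(** The odd part integrates to zero, so the integral of [F] is the mass of [one_], which is the atom
    of [nu] at the trivial character. *)
Lemma vdC_dual_atom (H : set G) : vdC_set R G H ->
  (forall h, H h -> fourier_coef nu h = 0) -> nu [set (dual1 : dual R G)] = 0%E.
Proof.
move=> /(_ _ X mu T act F LinftyF) vdC nuH.
have : cintegral mu F = 0 by apply: vdC => h Hh; rewrite correlationF nuH.
rewrite (_ : F = fun x => odd_part x + (\1_one_ x)%:C%C); last first.
  by apply/funext => x; rewrite /odd_part subrK.
rewrite cintegralD// cintegral_odd_part add0r => /(congr1 (@complex.Re R)) /=.
rewrite /Rintegral integral_indic// setIT [X in fine X]prod_probX//; last first.
  have [gamma gs] := countable_enum; exact: (measurable_dual1 gs).
rewrite [X in (_ * X)%E](probability_setT kappa) mule1 => nu0.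
(* [fine] also sends infinite values to 0, so finiteness of the mass is required here. *)
rewrite -[LHS]fineK ?nu0//; apply: fin_num_measure.
have [gamma gs] := countable_enum; exact: (measurable_dual1 gs).
Qed.

End DualToSystem.

Theorem theorem1p14 (R : realType) (G : zmodType)
    (G_countable : countable [set: G])
    (H : set G) (H_sub : H `<=` [set: G] `\ 0) :
  vdC_set R G H <->
  forall mu : probability (borel_dual R G) R,
    (forall h, H h -> fourier_coef mu h = 0) ->
    mu [set (dual1 : dual R G)] = 0%E.
Proof.
split=> [vdC nu|]; last exact: vdC_of_dual.
have [kappa [kappa_circle kappa_rot]] := @circle_measure R.
exact: (vdC_dual_atom G_countable kappa_circle kappa_rot vdC).
Qed.
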